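(* Let $A$ and $B$ be C*-algebras and let $(\mathsf{X}, \varphi)$ be an $(A,B)$ C*-correspondence. Then there is a unique $A$-valued left inner product on $\mathsf{X}$ making it a Hilbert $A$-$B$-bimodule if and only if $A$ has an ideal $J$ such that $J$ is $*$-isomorphic to $\mathcal{K}_B(\mathsf{X})$ via $\varphi|_{J}$.
   Context: An $(A,B)$ C*-correspondence is a pair $(\mathsf{X},\varphi)$ where $\mathsf{X}$ is a right Hilbert $B$-module and $\varphi\colon A\to\mathcal{L}_B(\mathsf{X})$ is a $*$-homomorphism; here $\mathcal{L}_B(\mathsf{X})$ denotes the C*-algebra of adjointable maps $\mathsf{X}\to\mathsf{X}$. The inner product $\langle-,-\rangle_B$ is linear in the second variable and conjugate linear in the first. For $x,y\in\mathsf{X}$, $\theta_{x,y}\in\mathcal{L}_B(\mathsf{X})$ is given by $\theta_{x,y}(z)=x\langle y,z\rangle_B$, and $\mathcal{K}_B(\mathsf{X})=\overline{\mathrm{span}\{\theta_{x,y}\colon x,y\in\mathsf{X}\}}$ is the algebra of compact-module maps. Ideals of C*-algebras are closed and two-sided. A Hilbert $A$-$B$-bimodule is a complex vector space $\mathsf{X}$ that is a left Hilbert $A$-module (with $A$-valued inner product ${}_A\langle-,-\rangle$, linear in the first variable and conjugate linear in the second) and a right Hilbert $B$-module such that ${}_A\langle x,y\rangle z=x\langle y,z\rangle_B$ for all $x,y,z\in\mathsf{X}$. In the claim, the right Hilbert $B$-module structure is the given one, and the left action of $A$ on $\mathsf{X}$ is the one given by $\varphi$. *)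

(* Defs.v *)
From HB Require Import structures.
From mathcomp Require Import all_boot all_order all_algebra.
From mathcomp Require Import complex.
From mathcomp Require Import all_classical all_reals all_analysis.

Set Implicit Arguments.
Unset Strict Implicit.
Unset Printing Implicit Defensive.

Import Order.TTheory GRing.Theory Num.Theory.
Import numFieldNormedType.Exports.

Local Open Scope classical_set_scope.
Local Open Scope ring_scope.
Local Open Scope complex_scope.

(* C*-algebras are not assumed unital, so the product is not MathComp's ring
   product. *)
HB.mixin Record isStarAlgebra (R : realType) (A : Type)
    of GRing.Lmodule R[i] A := {
  smul : A -> A -> A;
  star : A -> A;
  smulA : forall a b c, smul a (smul b c) = smul (smul a b) c;
  smulDl : forall a b c, smul (a + b) c = smul a c + smul b c;
  smulDr : forall a b c, smul a (b + c) = smul a b + smul a c;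
  smulZl : forall (k : R[i]) a b, smul (k *: a) b = k *: smul a b;
  smulZr : forall (k : R[i]) a b, smul a (k *: b) = k *: smul a b;
  starK : forall a, star (star a) = a;
  starD : forall a b, star (a + b) = star a + star b;
  starZ : forall (k : R[i]) a, star (k *: a) = conjc k *: star a;
  starM : forall a b, star (smul a b) = smul (star b) (star a)
}.

#[short(type="starAlgType")]
HB.structure Definition StarAlgebra (R : realType) :=
  { A of isStarAlgebra R A & GRing.Lmodule R[i] A }.

HB.mixin Record StarAlgebra_isCStar (R : realType) (A : Type)
    of StarAlgebra R A & CompleteNormedModule R[i] A := {
  norm_smul : forall a b : A, `|smul a b| <= `|a| * `|b|;
  cstar_identity : forall a : A, `|smul (star a) a| = `|a| ^+ 2
}.

#[short(type="cstarAlgType")]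
HB.structure Definition CStarAlgebra (R : realType) :=
  { A of StarAlgebra_isCStar R A & StarAlgebra R A &
         CompleteNormedModule R[i] A }.

Notation "a ** b" := (smul a b) (at level 40, left associativity) : ring_scope.

Section CStarNotions.
Context {R : realType}.

Definition star_hom (A B : starAlgType R) (f : A -> B) : Prop :=
  [/\ forall a b, f (a + b) = f a + f b,
      forall (k : R[i]) a, f (k *: a) = k *: f a,
      forall a b, f (a ** b) = f a ** f b
    & forall a, f (star a) = star (f a)].

Definition cstar_pos (A : starAlgType R) (a : A) : Prop :=
  exists b : A, a = star b ** b.

Definition cstar_ideal (A : cstarAlgType R) (J : set A) : Prop :=
  [/\ closed J,
      J 0,
      (forall a b, J a -> J b -> J (a + b)),
      (forall (k : R[i]) a, J a -> J (k *: a))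
    & (forall a b, J b -> J (a ** b) /\ J (b ** a))].

Definition ip_norm (A : cstarAlgType R) (X : Type) (ip : X -> X -> A) (x : X)
  : R[i] := sqrtC `|ip x x|.

End CStarNotions.

HB.mixin Record isHilbertModule (R : realType) (B : cstarAlgType R) (X : Type)
    of CompleteNormedModule R[i] X := {
  ract : X -> B -> X;
  ractDl : forall x y b, ract (x + y) b = ract x b + ract y b;
  ractDr : forall x b c, ract x (b + c) = ract x b + ract x c;
  ractZl : forall (k : R[i]) x b, ract (k *: x) b = k *: ract x b;
  ractZr : forall (k : R[i]) x b, ract x (k *: b) = k *: ract x b;
  ractM : forall x b c, ract x (b ** c) = ract (ract x b) c;
  rip : X -> X -> B;
  ripDr : forall x y z, rip x (y + z) = rip x y + rip x z;
  ripZr : forall (k : R[i]) x y, rip x (k *: y) = k *: rip x y;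
  rip_act : forall x y b, rip x (ract y b) = rip x y ** b;
  rip_star : forall x y, star (rip x y) = rip y x;
  rip_pos : forall x, cstar_pos (rip x x);
  rip_eq0 : forall x, rip x x = 0 -> x = 0;
  hilbert_norm : forall x, `|x| = ip_norm rip x
}.

#[short(type="hilbertModType")]
HB.structure Definition HilbertModule (R : realType) (B : cstarAlgType R) :=
  { X of isHilbertModule R B X & CompleteNormedModule R[i] X }.

Section Adjointable.
Context {R : realType} {B : cstarAlgType R} {X : hilbertModType B}.
Implicit Types (x y z : X) (S T : X -> X).

Lemma ripDl x y z : rip (x + y) z = rip x z + rip y z.
Proof. by rewrite -rip_star ripDr starD !rip_star. Qed.

Lemma ripZl (k : R[i]) x y : rip (k *: x) y = conjc k *: rip x y.
Proof. by rewrite -rip_star ripZr starZ rip_star. Qed.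

Lemma rip_actl x y b : rip (ract x b) y = star b ** rip x y.
Proof. by rewrite -rip_star rip_act starM rip_star. Qed.

Lemma rip0r x : rip x 0 = 0.
Proof. by rewrite -(scale0r (0 : X)) ripZr scale0r. Qed.

Lemma rip0l x : rip 0 x = 0.
Proof. by rewrite -(scale0r (0 : X)) ripZl rmorph0 scale0r. Qed.

Lemma ripNr x y : rip x (- y) = - rip x y.
Proof. by rewrite -scaleN1r ripZr scaleN1r. Qed.

Lemma rip_injr x y : (forall z, rip z x = rip z y) -> x = y.
Proof.
move=> xy; apply/eqP; rewrite -subr_eq0; apply/eqP/rip_eq0.
by rewrite ripDr ripNr xy subrr.
Qed.

Lemma rip_injl x y : (forall z, rip x z = rip y z) -> x = y.
Proof.
by move=> xy; apply: rip_injr => z; rewrite -rip_star xy rip_star.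
Qed.

Definition adjoint_pair T S : Prop := forall x y, rip (T x) y = rip x (S y).

Definition adjointable : {pred X -> X} :=
  fun T => `[< exists S, adjoint_pair T S >].

Lemma adjointableP T : reflect (exists S, adjoint_pair T S) (T \in adjointable).
Proof. exact: asboolP. Qed.

Lemma adjoint_pairC T S : adjoint_pair T S -> adjoint_pair S T.
Proof. by move=> TS x y; rewrite -rip_star -TS rip_star. Qed.

Lemma adjoint_pair_uniq T S S' :
  adjoint_pair T S -> adjoint_pair T S' -> S = S'.
Proof.
by move=> TS TS'; apply/funext => y; apply: rip_injr => x; rewrite -TS TS'.
Qed.

Lemma adjoint_pairD T S T' S' : adjoint_pair T S -> adjoint_pair T' S' ->
  adjoint_pair (T + T') (S + S').
Proof. by move=> TS TS' x y; rewrite ripDl ripDr TS TS'. Qed.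

Lemma adjoint_pairZ (k : R[i]) T S : adjoint_pair T S ->
  adjoint_pair (k *: T) (conjc k *: S).
Proof. by move=> TS x y; rewrite ripZl ripZr TS. Qed.

Lemma adjoint_pair_comp T S T' S' : adjoint_pair T S -> adjoint_pair T' S' ->
  adjoint_pair (T \o T') (S' \o S).
Proof. by move=> TS TS' x y /=; rewrite TS TS'. Qed.

Lemma adjointable_submod_closed : submod_closed adjointable.
Proof.
split.
  by apply/adjointableP; exists 0 => x y; rewrite [LHS]rip0l [RHS]rip0r.
move=> k S T /adjointableP[S' SS'] /adjointableP[T' TT'].
apply/adjointableP; exists (conjc k *: S' + T').
by apply: adjoint_pairD => //; exact: adjoint_pairZ.
Qed.

HB.instance Definition _ := GRing.isSubmodClosed.Build R[i] (X -> X) adjointable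
  adjointable_submod_closed.

End Adjointable.

Section AdjointableAlgebra.
Context {R : realType} {B : cstarAlgType R} (X : hilbertModType B).

(* The algebra of adjointable maps.  Linearity and boundedness follow from the
   existence of an adjoint. *)
Record adjop := Adjop { adjop_fun :> X -> X;
                        adjopP : adjop_fun \in @adjointable R B X }.

HB.instance Definition _ := [isSub for adjop_fun].
HB.instance Definition _ := [Choice of adjop by <:].
HB.instance Definition _ := [SubChoice_isSubLmodule of adjop by <:].

Lemma adjop_eqP (S T : adjop) : (S : X -> X) = T -> S = T.
Proof. exact: val_inj. Qed.

Definition adjoint_fun (T : adjop) : X -> X :=
  sval (cid (elimT (adjointableP T) (adjopP T))).

Lemma adjoint_funP (T : adjop) : adjoint_pair T (adjoint_fun T).
Proof. exact: (svalP (cid _)). Qed.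

Fact adjoint_fun_subproof (T : adjop) : adjoint_fun T \in @adjointable R B X.
Proof.
by apply/adjointableP; exists T; exact/adjoint_pairC/adjoint_funP.
Qed.

Definition adjop_star (T : adjop) : adjop := Adjop (adjoint_fun_subproof T).

Fact adjop_mul_subproof (S T : adjop) : S \o T \in @adjointable R B X.
Proof.
apply/adjointableP; exists (adjoint_fun T \o adjoint_fun S).
by apply: adjoint_pair_comp; exact: adjoint_funP.
Qed.

Definition adjop_mul (S T : adjop) : adjop := Adjop (adjop_mul_subproof S T).

Lemma adjop_star_eq (T S : adjop) : adjoint_pair T S -> adjop_star T = S.
Proof.
by move=> TS; apply/adjop_eqP/(adjoint_pair_uniq _ TS)/adjoint_funP.
Qed.

Lemma adjopD (T : adjop) x y : T (x + y) = T x + T y.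
Proof.
by apply: rip_injl => z; rewrite adjoint_funP !ripDl !adjoint_funP.
Qed.

Lemma adjopZ (T : adjop) (k : R[i]) x : T (k *: x) = k *: T x.
Proof.
by apply: rip_injl => z; rewrite adjoint_funP !ripZl !adjoint_funP.
Qed.

Let adjop_mulA (S T U : adjop) :
  adjop_mul S (adjop_mul T U) = adjop_mul (adjop_mul S T) U.
Proof. exact: adjop_eqP. Qed.

Let adjop_mulDl (S T U : adjop) :
  adjop_mul (S + T) U = adjop_mul S U + adjop_mul T U.
Proof. exact: adjop_eqP. Qed.

Let adjop_mulDr (S T U : adjop) :
  adjop_mul S (T + U) = adjop_mul S T + adjop_mul S U.
Proof. by apply/adjop_eqP/funext => x; rewrite /= adjopD. Qed.

Let adjop_mulZl (k : R[i]) (S T : adjop) :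
  adjop_mul (k *: S) T = k *: adjop_mul S T.
Proof. exact: adjop_eqP. Qed.

Let adjop_mulZr (k : R[i]) (S T : adjop) :
  adjop_mul S (k *: T) = k *: adjop_mul S T.
Proof. by apply/adjop_eqP/funext => x; rewrite /= adjopZ. Qed.

Let adjop_starK (T : adjop) : adjop_star (adjop_star T) = T.
Proof. exact/adjop_star_eq/adjoint_pairC/adjoint_funP. Qed.

Let adjop_starD (S T : adjop) :
  adjop_star (S + T) = adjop_star S + adjop_star T.
Proof. by apply/adjop_star_eq/adjoint_pairD; exact: adjoint_funP. Qed.

Let adjop_starZ (k : R[i]) (T : adjop) :
  adjop_star (k *: T) = conjc k *: adjop_star T.
Proof. by apply/adjop_star_eq/adjoint_pairZ; exact: adjoint_funP. Qed.

Let adjop_starM (S T : adjop) :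
  adjop_star (adjop_mul S T) = adjop_mul (adjop_star T) (adjop_star S).
Proof. by apply/adjop_star_eq/adjoint_pair_comp; exact: adjoint_funP. Qed.

HB.instance Definition _ := isStarAlgebra.Build R adjop
  adjop_mulA adjop_mulDl adjop_mulDr adjop_mulZl adjop_mulZr
  adjop_starK adjop_starD adjop_starZ adjop_starM.

(* Every adjointable map is bounded, so this supremum is in fact finite.  Norms
   take values in R[i], whence the real part. *)
Definition opnorm (T : adjop) : \bar R :=
  ereal_sup [set (complex.Re `|T x|)%:E | x in [set x : X | `|x| <= 1]].

Fact rank_one_subproof (x y : X) :
  (fun z => ract x (rip y z)) \in @adjointable R B X.
Proof.
apply/adjointableP; exists (fun z => ract y (rip x z)) => z w /=.
by rewrite rip_actl rip_act rip_star.
Qed.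

Definition rank_one (x y : X) : adjop := Adjop (rank_one_subproof x y).

Definition rank_one_span : set adjop :=
  [set T | exists n (c : 'I_n -> R[i]) (x y : 'I_n -> X),
     T = \sum_(i < n) c i *: rank_one (x i) (y i)].

Definition compact_ops : set adjop :=
  [set T | forall e : R, 0 < e ->
     exists2 S, rank_one_span S & (opnorm (T - S)%R < e%:E)%E].

End AdjointableAlgebra.

Arguments rank_one_span {R B} X.
Arguments compact_ops {R B} X.

Section Bimodule.
Context {R : realType}.

Definition norm_complete (X : zmodType) (N : X -> R[i]) : Prop :=
  forall u : nat -> X,
    (forall e : R[i], 0 < e -> exists n0 : nat, forall m n,
       (n0 <= m)%N -> (n0 <= n)%N -> N (u m - u n) < e) ->
    exists l : X, forall e : R[i], 0 < e -> exists n0 : nat, forall n,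
       (n0 <= n)%N -> N (u n - l) < e.

Record left_hilbert_module (A : cstarAlgType R) (X : lmodType R[i])
    (act : A -> X -> X) (ip : X -> X -> A) : Prop := LeftHilbertModule {
  lactDl : forall a b x, act (a + b) x = act a x + act b x;
  lactDr : forall a x y, act a (x + y) = act a x + act a y;
  lactZl : forall (k : R[i]) a x, act (k *: a) x = k *: act a x;
  lactZr : forall (k : R[i]) a x, act a (k *: x) = k *: act a x;
  lactM : forall a b x, act (a ** b) x = act a (act b x);
  lipDl : forall x y z, ip (x + y) z = ip x z + ip y z;
  lipZl : forall (k : R[i]) x y, ip (k *: x) y = k *: ip x y;
  lip_act : forall a x y, ip (act a x) y = a ** ip x y;
  lip_star : forall x y, star (ip x y) = ip y x;
  lip_pos : forall x, cstar_pos (ip x x);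
  lip_eq0 : forall x, ip x x = 0 -> x = 0;
  lip_complete : norm_complete (ip_norm ip)
}.

(* [act] is the left action of A and [ip] the A-valued inner product; the right
   Hilbert B-module structure is that of X. *)
Definition hilbert_bimodule (A B : cstarAlgType R) (X : hilbertModType B)
    (act : A -> X -> X) (ip : X -> X -> A) : Prop :=
  left_hilbert_module act ip /\
  forall x y z : X, act (ip x y) z = ract x (rip y z).

End Bimodule.

(* Main.v *)
Require Import Defs.
From HB Require Import structures.
From mathcomp Require Import all_boot all_order all_algebra.
From mathcomp Require Import complex.
From mathcomp Require Import all_classical all_reals all_analysis.
From mathcomp Require Import ring lra.

Set Implicit Arguments.
Unset Strict Implicit.
Unset Printing Implicit Defensive.

Import Order.TTheory GRing.Theory Num.Theory.
Import numFieldNormedType.Exports.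

Local Open Scope classical_set_scope.
Local Open Scope ring_scope.
Local Open Scope complex_scope.

(** The proof rests on the order structure of C*-algebras, which is obtained
    here from square roots alone, without spectra.

    Square roots.  For a self-adjoint contraction h, the iteration
    s_(n+1) = (h + s_n^2) / 2 from s_0 = 0 converges at least as fast as it does
    for h = 1, and its limit satisfies 1 - h = (1 - s)^2 ([op_one_sub_sqrt]).
    Call a self-adjoint operator T positive if |t - T| <= t for some t > 0.
    This condition is additive and gives T a square root.  Squares of
    self-adjoint operators are positive because k + i sqrt(1 - k^2) is unitary
    when |k| <= 1, and Kaplansky's argument then shows that T^* T is always
    positive ([pos_star_mul]).  A C*-algebra acts on itself by left
    multiplication, so it inherits these facts: |p| <= |p + q| for positive p
    and q ([rnorm_bpos_le]), and h = 2 s - s^2 is solvable in it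
    ([cstar_one_sub_sqrt]).  The Cauchy-Schwarz inequality in Hilbert modules
    and the contractivity of phi follow.

    From a bimodule to an ideal.  The compatibility of the two inner products
    says phi (ip x y) = theta_(x,y), so phi maps the closed span J of the values
    of ip into the compact operators.  If phi d = 0 then d ip(x,y) = ip(d x, y)
    vanishes, so d kills J and phi is injective on the self-adjoint ideal J.  It
    is isometric on the span ([ip_sum_isometric]), so its image is closed and
    contains every compact operator.

    From an ideal to a bimodule.  Let ip x y be the element of J that phi maps
    to theta_(x,y).  Its algebraic properties can be checked after applying phi.
    Positivity holds because theta_(x,x) is the square of a self-adjoint compact
    operator ([rank_one_sqrt]), which lifts to J.  Completeness holds because
    |ip x x| = |<x,x>| in any such situation ([rnorm_ip]), so the two norms of X
    are the same.  Uniqueness is automatic: the difference d of two such inner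
    products at a pair of vectors is in the kernel of phi and so kills all the
    values of both, whence d d^* = 0. *)

(** * Real-valued norms *)
Section RealNorm.
Context {R : realType} {V : normedModType R[i]}.
Implicit Types (x y : V) (t : R).

(** The norms take values in [R[i]], which is only partially ordered; moving
    them to [R] gives access to the decision procedures for real fields. *)
Definition rnorm x : R := complex.Re `|x|.

Lemma rnormE x : `|x| = (rnorm x)%:C.
Proof. by rewrite /rnorm RRe_real // ger0_real. Qed.

Lemma rnorm_ge0 x : 0 <= rnorm x.
Proof. by rewrite -ler0c -rnormE. Qed.

Lemma ler_rnormD x y : rnorm (x + y) <= rnorm x + rnorm y.
Proof. by rewrite -lecR rmorphD /= -!rnormE ler_normD. Qed.

Lemma rnormN x : rnorm (- x) = rnorm x.
Proof. by rewrite /rnorm normrN. Qed.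

Lemma rnormB x y : rnorm (x - y) = rnorm (y - x).
Proof. by rewrite /rnorm distrC. Qed.

Lemma ler_rnormB x y : rnorm (x - y) <= rnorm x + rnorm y.
Proof. by rewrite -(rnormN y) ler_rnormD. Qed.

Lemma ler_rdistD z x y : rnorm (x - y) <= rnorm (x - z) + rnorm (z - y).
Proof. by rewrite -[x - y](subrKA z) ler_rnormD. Qed.

Lemma rnorm0 : rnorm 0 = 0.
Proof. by rewrite /rnorm normr0. Qed.

Lemma rnorm_le0 x : rnorm x <= 0 -> x = 0.
Proof.
move=> x0; apply/eqP; rewrite -normr_eq0 rnormE eq_le.
by rewrite lecR x0 ler0c rnorm_ge0.
Qed.

Lemma rnormZ (k : R[i]) x : rnorm (k *: x) = complex.Re `|k| * rnorm x.
Proof.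
by apply: complexI; rewrite rmorphM /= -!rnormE normrZ; congr (_ * _).
Qed.

Lemma rnormZr t x : rnorm (t%:C *: x) = `|t| * rnorm x.
Proof. by rewrite rnormZ normc_def /= expr0n addr0 sqrtr_sqr. Qed.

Lemma rnorm_gt0 x : x != 0 -> 0 < rnorm x.
Proof.
move=> x0; rewrite lt_def rnorm_ge0 andbT; apply: contraNneq x0 => x0.
by apply/eqP/rnorm_le0; rewrite x0.
Qed.

Lemma rnorm_normalize x : x != 0 -> rnorm ((rnorm x)^-1%:C *: x) = 1.
Proof.
by move=> /rnorm_gt0 x0; rewrite rnormZr ger0_norm ?invr_ge0 ?(ltW x0) // mulVf ?gt_eqF.
Qed.

Lemma rnorm_i x : rnorm ('i%C *: x) = rnorm x.
Proof. by rewrite rnormZ normc_def /= expr0n add0r expr1n sqrtr1 mul1r. Qed.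

End RealNorm.

Lemma ler_sqr_cancel (R : realDomainType) (a b : R) : 0 <= b -> a * a <= b * a -> a <= b.
Proof. by move=> b0 ab; rewrite leNgt; apply/negP => ba; nra. Qed.

Lemma posC_Re (R : realType) (e : R[i]) : 0 < e -> exists2 r : R, 0 < r & e = r%:C.
Proof.
move=> e0; have eE : (complex.Re e)%:C = e by rewrite RRe_real // gtr0_real.
by exists (complex.Re e) => //; rewrite -ltcR eE.
Qed.

Section Complete.
Context {R : realType} {V : completeNormedModType R[i]}.

Lemma rnorm_complete (u : nat -> V) (d : nat -> R) :
    (forall e, 0 < e -> exists n, d n < e) ->
    (forall m n, (n <= m)%N -> rnorm (u m - u n) <= d n) ->
  exists l, forall n, rnorm (l - u n) <= d n.
Proof.
move=> d0 ud.
have /cauchy_cvgP/cvg_ex[l ul] : cauchy (u @ \oo).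
  apply: cauchy_exP => _ /posC_Re[e e0 ->].
  have [n dn] := d0 _ e0; exists (u n), n => // m /= nm.
  rewrite -ball_normE /ball_/= distrC rnormE ltcR.
  exact: le_lt_trans (ud _ _ nm) dn.
exists l => n; apply/ler_addgt0Pr => e e0.
have /cvgrPdist_lt/(_ e%:C) := ul; rewrite ltcR => /(_ e0)[N _ Nl].
have /Nl/= := leq_maxl N n; rewrite rnormE ltcR => lt_e.
have := ler_rdistD (u (maxn N n)) l (u n).
by have := ud _ _ (leq_maxr N n); lra.
Qed.

End Complete.

(** * Elementary identities in C*-algebras and algebras of operators *)
Section StarAlgebraTheory.
Context {R : realType} {A : starAlgType R}.
Implicit Types a b c : A.

Lemma smul0l a : 0 ** a = 0.
Proof. by rewrite -{1}(scale0r (0 : A)) smulZl scale0r. Qed.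

Lemma smul0r a : a ** 0 = 0.
Proof. by rewrite -{1}(scale0r (0 : A)) smulZr scale0r. Qed.

Lemma smulNl a b : (- a) ** b = - (a ** b).
Proof. by rewrite -scaleN1r smulZl scaleN1r. Qed.

Lemma smulNr a b : a ** (- b) = - (a ** b).
Proof. by rewrite -scaleN1r smulZr scaleN1r. Qed.

Lemma smulBl a b c : (a - b) ** c = a ** c - b ** c.
Proof. by rewrite smulDl smulNl. Qed.

Lemma smulBr a b c : a ** (b - c) = a ** b - a ** c.
Proof. by rewrite smulDr smulNr. Qed.

Lemma star0 : star (0 : A) = 0.
Proof. by rewrite -{1}(scale0r (0 : A)) starZ rmorph0 scale0r. Qed.

Lemma starN a : star (- a) = - star a.
Proof. by rewrite -scaleN1r starZ rmorphN1 scaleN1r. Qed.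

Lemma starB a b : star (a - b) = star a - star b.
Proof. by rewrite starD starN. Qed.

Lemma starZr (t : R) a : star (t%:C *: a) = t%:C *: star a.
Proof. by rewrite starZ conjc_real. Qed.

Lemma star_sqr a : star (star a ** a) = star a ** a.
Proof. by rewrite starM starK. Qed.

End StarAlgebraTheory.

Section CStarNorm.
Context {R : realType} {A : cstarAlgType R}.
Implicit Types a b : A.

Lemma rnormM a b : rnorm (a ** b) <= rnorm a * rnorm b.
Proof. by rewrite -lecR rmorphM /= -!rnormE norm_smul. Qed.

Lemma rnorm_cstar a : rnorm (star a ** a) = rnorm a ^+ 2.
Proof. by apply: complexI; rewrite rmorphXn /= -!rnormE cstar_identity. Qed.

Lemma cstar_eq0 a : star a ** a = 0 -> a = 0.
Proof.
move=> aa0; apply: rnorm_le0; have := rnorm_cstar a.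
by rewrite aa0 rnorm0 => /esym/eqP; rewrite sqrf_eq0 => /eqP ->.
Qed.

Lemma rnorm_star a : rnorm (star a) = rnorm a.
Proof.
have le b : rnorm b <= rnorm (star b).
  have [-> //|b0] := eqVneq b 0; first by rewrite star0.
  rewrite -(ler_pM2r (rnorm_gt0 b0)).
  by rewrite -expr2 -rnorm_cstar rnormM.
by apply/eqP; rewrite eq_le le andbT -{2}[a]starK le.
Qed.

Lemma rnorm_sqr_sa a : star a = a -> rnorm (a ** a) = rnorm a ^+ 2.
Proof. by move=> sa; rewrite -{1}sa rnorm_cstar. Qed.

End CStarNorm.

Section OperatorRing.
Context {R : realType} {B : cstarAlgType R} (X : hilbertModType B).

Fact adjop_id_subproof : (id : X -> X) \in @adjointable R B X.
Proof. by apply/adjointableP; exists id. Qed.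

Let adjop_id : adjop X := Adjop adjop_id_subproof.

Let adjop_mul1r (T : adjop X) : adjop_id ** T = T.
Proof. exact: adjop_eqP. Qed.

Let adjop_mulr1 (T : adjop X) : T ** adjop_id = T.
Proof. exact: adjop_eqP. Qed.

(** In contrast with a general C*-algebra, the algebra of adjointable maps always has a unit, and
    the ring notations and the theory of commuting elements apply to it.  The
    trivial ring has to be allowed, as [X] may be zero. *)
HB.instance Definition _ := GRing.Zmodule_isPzRing.Build (adjop X)
  (@smulA R (adjop X)) adjop_mul1r adjop_mulr1
  (@smulDl R (adjop X)) (@smulDr R (adjop X)).

End OperatorRing.

Section Operators.
Context {R : realType} {B : cstarAlgType R} {X : hilbertModType B}.
Implicit Types (x y z : X) (S T : adjop X) (s t : R) (k : R[i]).

Lemma op_eqP S T : (forall x, S x = T x) -> S = T.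
Proof. by move=> ST; apply/adjop_eqP/funext. Qed.

Lemma opD S T x : (S + T) x = S x + T x. Proof. by []. Qed.
Lemma opN T x : (- T) x = - T x. Proof. by []. Qed.
Lemma opB S T x : (S - T) x = S x - T x. Proof. by []. Qed.
Lemma opZ k T x : (k *: T) x = k *: T x. Proof. by []. Qed.
Lemma opM S T x : (S * T) x = S (T x). Proof. by []. Qed.
Lemma op0 x : (0 : adjop X) x = 0. Proof. by []. Qed.

Lemma opx0 T : T 0 = 0.
Proof. by rewrite -{1}(scale0r (0 : X)) adjopZ scale0r. Qed.

Lemma opZl k S T : (k *: S) * T = k *: (S * T).
Proof. exact: smulZl. Qed.

Lemma opZr k S T : S * (k *: T) = k *: (S * T).
Proof. exact: smulZr. Qed.

Lemma opstarM S T : star (S * T) = star T * star S.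
Proof. exact: starM. Qed.

Lemma rip_op T x y : rip (T x) y = rip x (star T y).
Proof. exact: adjoint_funP. Qed.

Lemma rip_opr T x y : rip x (T y) = rip (star T x) y.
Proof. by rewrite rip_op starK. Qed.

Lemma op_sa T : (forall x y, rip (T x) y = rip x (T y)) -> star T = T.
Proof. exact: adjop_star_eq. Qed.

Lemma opstar1 : star (1 : adjop X) = 1.
Proof. exact: op_sa. Qed.

Lemma ripNl x y : rip (- x) y = - rip x y.
Proof. by rewrite -rip_star ripNr starN rip_star. Qed.

Lemma ripBr x y z : rip x (y - z) = rip x y - rip x z.
Proof. by rewrite ripDr ripNr. Qed.

Lemma ripBl x y z : rip (x - y) z = rip x z - rip y z.
Proof. by rewrite ripDl ripNl. Qed.

Lemma rnorm_rip x : rnorm (rip x x) = rnorm x ^+ 2.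
Proof.
apply: complexI; rewrite rmorphXn /= -!rnormE hilbert_norm /ip_norm.
by rewrite sqrtCK.
Qed.

Lemma rip_rnorm0 T : star T * T = 0 -> T = 0.
Proof.
move=> TT; apply: op_eqP => x; apply: rip_eq0.
by rewrite rip_op -opM TT rip0r.
Qed.

(** A bound on the operator norm, used in place of [opnorm] because it composes
    without finiteness conditions. *)
Definition bnd T t := forall x, rnorm (T x) <= t * rnorm x.

Lemma bnd0 : bnd 0 0.
Proof. by move=> x; rewrite op0 rnorm0 mul0r. Qed.

Lemma bnd1 : bnd 1 1.
Proof. by move=> x; rewrite mul1r. Qed.

Lemma bnd_le T s t : s <= t -> bnd T s -> bnd T t.
Proof. by move=> st Ts x; rewrite (le_trans (Ts x)) ?ler_wpM2r ?rnorm_ge0. Qed.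

Lemma bndD S T s t : bnd S s -> bnd T t -> bnd (S + T) (s + t).
Proof.
by move=> Ss Tt x; rewrite opD mulrDl (le_trans (ler_rnormD _ _)) ?lerD.
Qed.

Lemma bndN T t : bnd T t -> bnd (- T) t.
Proof. by move=> Tt x; rewrite opN rnormN. Qed.

Lemma bndB S T s t : bnd S s -> bnd T t -> bnd (S - T) (s + t).
Proof. by move=> Ss /bndN; apply: bndD. Qed.

Lemma bndM S T s t : 0 <= s -> bnd S s -> bnd T t -> bnd (S * T) (s * t).
Proof.
move=> s0 Ss Tt x; rewrite opM -mulrA (le_trans (Ss _)) //.
exact: ler_wpM2l.
Qed.

Lemma bndZ s T t : 0 <= s -> bnd T t -> bnd (s%:C *: T) (s * t).
Proof.
by move=> s0 Tt x; rewrite opZ rnormZr ger0_norm // -mulrA ler_wpM2l.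
Qed.

Lemma bnd_i T t : bnd T t -> bnd ('i%C *: T) t.
Proof. by move=> Tt x; rewrite opZ rnorm_i. Qed.

End Operators.

(** * Square roots of self-adjoint contractions *)
Section ScalarIteration.
Context {R : realType}.

(** The iteration for square roots in the case h = 1.  The operator iteration is
    a polynomial in h with nonnegative coefficients, so this sequence dominates
    it and its increments. *)
Fixpoint sqseq n : R :=
  if n is n'.+1 then 2^-1 * (1 + sqseq n' * sqseq n') else 0.

Definition sqgap n := 1 - sqseq n.

Lemma sqseq_itv n : 0 <= sqseq n <= 1.
Proof. by elim: n => [|n IH] /=; rewrite ?lexx ?ler01 //; nra. Qed.

Lemma sqseq_ge0 n : 0 <= sqseq n.
Proof. by case/andP: (sqseq_itv n). Qed.

Lemma sqseq_mono n : sqseq n <= sqseq n.+1.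
Proof. by rewrite /=; have := sqseq_itv n; nra. Qed.

Lemma sqseq_homo m n : (n <= m)%N -> sqseq n <= sqseq m.
Proof.
by apply: (homo_leq (r := <=%R)) => [//|y x z|k]; [exact: le_trans|exact: sqseq_mono].
Qed.

Lemma sqgap_ge0 n : 0 <= sqgap n.
Proof. by rewrite subr_ge0; case/andP: (sqseq_itv n). Qed.

Lemma sqgapS n : sqgap n.+1 = sqgap n - 2^-1 * (sqgap n * sqgap n).
Proof. by rewrite /sqgap /=; field. Qed.

Lemma sqgap_gt0 n : 0 < sqgap n.
Proof.
elim: n => [|n IH]; first by rewrite /sqgap subr0 ltr01.
have : sqgap n <= 1 by rewrite /sqgap lerBlDr lerDl sqseq_ge0.
by rewrite sqgapS; nra.
Qed.

(** The gap obeys d' = d - d^2 / 2, which decays like 2 / n. *)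
Lemma sqgap_le n : sqgap n * n.+2%:R <= 2.
Proof.
elim: n => [|n IH]; first by rewrite /sqgap subr0 mul1r.
have -> : n.+3%:R = n.+2%:R + 1 :> R by rewrite natr1.
have m2 : 2 <= n.+2%:R :> R by rewrite ler_nat.
have d0 := sqgap_ge0 n; rewrite sqgapS.
move: IH m2 d0; move: (n.+2%:R : R) (sqgap n) => m d dm m2 d0.
(* d - d^2/2 increases on [0, 1], so it is enough to treat the value d = 2/m *)
pose e := 2 / m; have em : e * m = 2 by rewrite mulfVK //; lra.
have [e0 e1] : 0 <= e /\ e <= 1 by split; nra.
have de : d <= e by nra.
have : d - 2^-1 * (d * d) <= e - 2^-1 * (e * e) by nra.
nra.
Qed.

Lemma sqgap_small (C e : R) : 0 < e -> exists n, C * sqgap n < e.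
Proof.
move=> e0; have [C0|C0] := leP C 0.
  exists 0%N; rewrite (le_lt_trans _ e0) //.
  by rewrite mulr_le0_ge0 ?sqgap_ge0.
have Ce0 : 0 <= C * 2 / e by rewrite divr_ge0 ?mulr_ge0 // ltW.
exists (Num.bound (C * 2 / e)); move: (archi_boundP Ce0).
set n := Num.bound _; rewrite ltr_pdivrMr // => Cn.
rewrite -(ltr_pM2r (ltr0Sn R n.+1)) -mulrA.
apply: (le_lt_trans (ler_wpM2l (ltW C0) (sqgap_le n))).
by apply: (lt_le_trans Cn); rewrite mulrC ler_pM2l // ler_nat ltnW.
Qed.

Lemma sqgap_eq0 (V : normedModType R[i]) (x : V) (C : R) :
  (forall n, rnorm x <= C * sqgap n) -> x = 0.
Proof.
move=> xC; apply: rnorm_le0; rewrite leNgt; apply/negP => x0.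
by have [n] := sqgap_small C x0; rewrite ltNge xC.
Qed.

End ScalarIteration.

Section SquareRoot.
Context {R : realType} {B : cstarAlgType R} {X : hilbertModType B}.
Implicit Types (x y : X) (S T G H : adjop X) (s t : R).

(** This inequality is a consequence of the theory below for the C*-algebra [B]
    acting on itself, where it is trivial.  Keeping it as a hypothesis lets the
    same theory serve twice, first for [B] and then for general modules. *)
Definition cauchy_schwarz : Prop :=
  forall x y : X, rnorm (rip x y) <= rnorm x * rnorm y.

Lemma halfD (V : lmodType R[i]) (x : V) :
  (2^-1 : R)%:C *: x + (2^-1 : R)%:C *: x = x.
Proof. by rewrite -scalerDl -rmorphD /= -div1r -splitr scale1r. Qed.

Lemma commZ G T (k : R[i]) : GRing.comm G T -> GRing.comm G (k *: T).
Proof. by move=> GT; rewrite /GRing.comm opZl opZr GT. Qed.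

Fixpoint opseq H n : adjop X :=
  if n is n'.+1 then (2^-1 : R)%:C *: (H + opseq H n' * opseq H n') else 0.

Lemma opseq_comm G H n : GRing.comm G H -> GRing.comm G (opseq H n).
Proof.
move=> GH; elim: n => [|n IH] /=; first exact: commr0.
by apply/commZ/commrD => //; apply: commrM.
Qed.

Lemma opseq_star H n : star H = H -> star (opseq H n) = opseq H n.
Proof.
move=> sH; elim: n => [|n IH] /=; first exact: star0.
by rewrite starZr starD opstarM IH sH.
Qed.

Lemma opseq_bnd H n : bnd H 1 -> bnd (opseq H n) (sqseq n).
Proof.
move=> H1; elim: n => [|n IH] /=; first exact: bnd0.
by apply: bndZ; rewrite ?invr_ge0 //; apply/bndD/bndM/IH; rewrite ?sqseq_ge0.
Qed.

Lemma comm_sqrB S T : GRing.comm S T ->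
  S * S - T * T = (S - T) * (S + T).
Proof.
by move=> ST; rewrite mulrBl !mulrDr ST opprD addrA addrK.
Qed.

Lemma opseq_bnd_step H n : bnd H 1 ->
  bnd (opseq H n.+1 - opseq H n) (sqseq n.+1 - sqseq n).
Proof.
move=> H1; have half0 : 0 <= 2^-1 :> R by rewrite invr_ge0.
elim: n => [|n IH].
  rewrite /= mulr0 !subr0 mul0r !addr0; exact: bndZ.
have -> : opseq H n.+2 - opseq H n.+1 = (2^-1 : R)%:C *:
   ((opseq H n.+1 - opseq H n) * (opseq H n.+1 + opseq H n)).
  rewrite -comm_sqrB; last by apply/opseq_comm/commr_sym/opseq_comm.
  have key P Q : (2^-1 : R)%:C *: (H + P) - (2^-1 : R)%:C *: (H + Q) =
      (2^-1 : R)%:C *: (P - Q).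
    by rewrite -scalerBr opprD addrACA subrr add0r.
  exact: key.
have -> : sqseq n.+2 - sqseq n.+1 = 2^-1 * ((sqseq n.+1 - sqseq n) *
   (sqseq n.+1 + sqseq n)) :> R by rewrite /=; field.
apply/bndZ/bndM => //; first by rewrite subr_ge0 sqseq_mono.
by apply: bndD; apply: opseq_bnd.
Qed.

Lemma opseq_bnd_diff H m n : bnd H 1 -> (n <= m)%N ->
  bnd (opseq H m - opseq H n) (sqseq m - sqseq n).
Proof.
move=> H1 /subnK <-; elim: (m - n)%N => [|k IH].
  by rewrite add0n !subrr; exact: bnd0.
rewrite addSn -[X in bnd X](subrKA (opseq H (k + n))).
by rewrite -[X in bnd _ X](subrKA (sqseq (k + n))); apply/bndD/IH/opseq_bnd_step.
Qed.

Hypothesis CS : cauchy_schwarz.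

(** A limit of self-adjoint operators is built pointwise.  Cauchy-Schwarz makes
    the inner product continuous, which shows that the limit is adjointable. *)
Lemma op_lim (s : nat -> adjop X) :
    (forall n, star (s n) = s n) ->
    (forall m n, (n <= m)%N -> bnd (s m - s n) (sqgap n)) ->
  exists2 S : adjop X, star S = S & forall n, bnd (S - s n) (sqgap n).
Proof.
move=> sas s_cauchy.
have /choice[S Ss] : forall x, exists y,
    forall n, rnorm (y - s n x) <= sqgap n * rnorm x.
  move=> x; apply: rnorm_complete => [e e0|m n nm]; last exact: s_cauchy.
  have [n] := sqgap_small (rnorm x) e0.
  by rewrite mulrC; exists n.
have SS x y : rip (S x) y = rip x (S y).
  apply/eqP; rewrite -subr_eq0; apply/eqP.
  apply: (@sqgap_eq0 _ _ _ (2 * (rnorm x * rnorm y))) => n.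
  have -> : rip (S x) y - rip x (S y) =
            rip (S x - s n x) y + rip x (s n y - S y).
    rewrite ripDr ripNr -[in rip (S x - _) y]rip_star ripDr ripNr starB !rip_star.
    by rewrite rip_op sas subrKA.
  apply: (le_trans (ler_rnormD _ _)).
  have := CS (S x - s n x) y; have := CS x (s n y - S y).
  have := Ss x n; have := Ss y n; rewrite (rnormB (s n y)).
  have := rnorm_ge0 x; have := rnorm_ge0 y; have := @sqgap_ge0 R n.
  nra.
have adjS : S \in @adjointable R B X by apply/adjointableP; exists S.
by exists (Adjop adjS) => [|n x]; [exact: op_sa|exact: Ss].
Qed.

Lemma bnd_small T C : (forall n, bnd T (C * sqgap n)) -> T = 0.
Proof.
move=> TC; apply: op_eqP => x.
apply: (@sqgap_eq0 _ _ _ (C * rnorm x)) => n.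
by rewrite mulrAC; exact: TC.
Qed.

Lemma op_lim_comm S G (s : nat -> adjop X) :
    (forall n, bnd (S - s n) (sqgap n)) ->
    (forall n, GRing.comm G (s n)) -> GRing.comm G S.
Proof.
move=> Ss Gs; apply: op_eqP => x; apply: rip_injr => y.
apply/eqP; rewrite -subr_eq0; apply/eqP.
apply: (@sqgap_eq0 _ _ _ (rnorm (star G y) * rnorm x + rnorm y * rnorm (G x))).
move=> n.
have -> : rip y ((G * S) x) - rip y ((S * G) x) =
    rip (star G y) ((S - s n) x) - rip y ((S - s n) (G x)).
  rewrite !opB !ripDr !ripNr !opM -rip_opr -[rip (star G y) (s n x)]rip_opr.
  by rewrite -[G (s n x)]opM Gs opM opprB addrA subrK.
apply: (le_trans (ler_rnormB _ _)).
have := CS (star G y) ((S - s n) x); have := CS y ((S - s n) (G x)).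
have := Ss n x; have := Ss n (G x).
have := rnorm_ge0 (star G y); have := rnorm_ge0 y; nra.
Qed.

(** The equation S + S = H + S * S is the fixed-point form of
    (1 - S)^2 = 1 - H.  The approximants are part of the conclusion, since one
    needs to know that S is a limit of polynomials in H. *)
Lemma op_one_sub_sqrt H : star H = H -> bnd H 1 ->
  exists S : adjop X, [/\ star S = S, bnd S 1, S + S = H + S * S,
    forall n, bnd (S - opseq H n) (sqgap n)
  & forall G, GRing.comm G H -> GRing.comm G S].
Proof.
move=> sH H1.
have [S sS Ss] : exists2 S : adjop X,
    star S = S & forall n, bnd (S - opseq H n) (sqgap n).
  apply: op_lim => [n|m n nm]; first exact: opseq_star.
  apply: bnd_le (opseq_bnd_diff H1 nm).
  by rewrite lerD2r; case/andP: (@sqseq_itv R m).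
have S1 : bnd S 1.
  rewrite -[S](subrK (opseq H 0)) -(subrK (sqseq 0) 1).
  by apply: bndD => //; apply: opseq_bnd.
exists S; split=> // [|G GH]; last first.
  by apply: op_lim_comm Ss _ => n; apply: opseq_comm.
apply/eqP; rewrite -subr_eq0; apply/eqP/(@bnd_small _ 4) => n.
set s := opseq H n; set s' := opseq H n.+1.
have HE : H = s' + s' - s * s by rewrite /s' /= halfD addrK.
have -> : S + S - (H + S * S) =
    (S - s') + (S - s') - ((S - s) * S + s * (S - s)).
  rewrite {1}HE mulrBl mulrBr subrKA opprB.
  by rewrite !opprD opprK (addrACA S (- s')) !addrA.
have gap_le : sqgap n.+1 <= sqgap n :> R.
  by rewrite lerD2l lerN2 sqseq_mono.
have gap0 := @sqgap_ge0 R n; have := @sqseq_itv R n => /andP[s0 s1].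
have Ss' := bnd_le gap_le (Ss n.+1).
have Ssn : bnd (S - s) (sqgap n) by exact: Ss.
have sn1 : bnd s 1 by apply: bnd_le s1 _; apply: opseq_bnd.
rewrite (_ : 4 * sqgap n = sqgap n + sqgap n + (sqgap n * 1 + 1 * sqgap n)).
  apply: bndB; first exact: bndD.
  apply: bndD; first by apply: bndM.
  by apply: bndM.
by ring.
Qed.

End SquareRoot.

(** * Positive operators *)
Local Notation "t %:op" := (t%:C *: (1 : adjop _))
  (at level 1, left associativity, format "t %:op") : ring_scope.

Section PositiveOperators.
Context {R : realType} {B : cstarAlgType R} {X : hilbertModType B}.
Implicit Types (x y : X) (S T G H K P Q : adjop X) (s t : R).
Hypothesis CS : @cauchy_schwarz R B X.

Lemma bnd_star T t : 0 <= t -> bnd T t -> bnd (star T) t.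
Proof.
move=> t0 Tt x; have := Tt (star T x).
have := rnorm_rip (star T x); rewrite rip_op starK => TTx.
have := CS x (T (star T x)); rewrite TTx.
have := rnorm_ge0 (star T x); have := rnorm_ge0 x.
move: (rnorm x) (rnorm (star T x)) (rnorm (T _)) => a b c a0 b0 bb cb.
by apply: ler_sqr_cancel; nra.
Qed.

Lemma bnd_cstar T t : 0 <= t -> bnd (star T * T) (t ^+ 2) -> bnd T t.
Proof.
move=> t0 TTt x; have := TTt x; have := CS x ((star T * T) x).
rewrite opM -rip_op rnorm_rip.
have := rnorm_ge0 (T x); have := rnorm_ge0 x.
move: (rnorm x) (rnorm (T x)) (rnorm (star T _)) => a b c a0 b0 h1 h2.
rewrite -(@ler_pXn2r _ 2) ?nnegrE ?mulr_ge0 //; nra.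
Qed.

Definition bdd T := exists2 t : R, 0 <= t & bnd T t.

Lemma bddD S T : bdd S -> bdd T -> bdd (S + T).
Proof.
move=> [s s0 Ss] [t t0 Tt]; exists (s + t); [exact: addr_ge0|exact: bndD].
Qed.

Lemma bddN T : bdd T -> bdd (- T).
Proof. by move=> [t t0 Tt]; exists t; last exact: bndN. Qed.

Lemma bddB S T : bdd S -> bdd T -> bdd (S - T).
Proof. by move=> bS /bddN; apply: bddD. Qed.

Lemma bddM S T : bdd S -> bdd T -> bdd (S * T).
Proof.
move=> [s s0 Ss] [t t0 Tt]; exists (s * t); [exact: mulr_ge0|exact: bndM].
Qed.

Lemma bdd_i T : bdd T -> bdd ('i%C *: T).
Proof. by move=> [t t0 Tt]; exists t; last exact: bnd_i. Qed.

Lemma bdd_star T : bdd T -> bdd (star T).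
Proof. by move=> [t t0 Tt]; exists t; last exact: bnd_star. Qed.

(** For commuting self-adjoint K and Q, the operator K + iQ behaves like a
    complex number with square modulus K^2 + Q^2. *)
Lemma op_sqrD K Q : star K = K -> star Q = Q -> GRing.comm K Q ->
  star (K + 'i%C *: Q) * (K + 'i%C *: Q) = K * K + Q * Q.
Proof.
move=> sK sQ KQ; rewrite starD starZ sK sQ mulrDl !mulrDr !(opZl, opZr) scalerA.
have -> : (conjc 'i * 'i = 1 :> R[i])%C by simpc.
rewrite scale1r KQ addrA -[K * K + _ + _]addrA -scalerDl.
have -> : ('i + conjc 'i = 0 :> R[i])%C by simpc.
by rewrite scale0r addr0.
Qed.

(** K and Q are the real and imaginary parts of K + iQ, whose norm is at most t
    by the C*-identity. *)
Lemma bnd_sqrD K Q t : star K = K -> star Q = Q -> GRing.comm K Q ->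
  0 <= t -> bnd (K * K + Q * Q) (t ^+ 2) -> bnd K t /\ bnd Q t.
Proof.
move=> sK sQ KQ t0; rewrite -op_sqrD // => /bnd_cstar -/(_ t0) Ut.
have U't := bnd_star t0 Ut.
set U := K + 'i%C *: Q in Ut U't.
have U'E : star U = K - 'i%C *: Q.
  by rewrite starD starZ sK sQ -scaleNr; congr (_ + _ *: _); simpc.
split=> x.
  have := bndD Ut U't x; rewrite U'E addrACA subrr addr0 opD -[K x]scale1r.
  rewrite -scalerDl (_ : 1 + 1 = (2 : R)%:C); last by rewrite rmorphD.
  rewrite rnormZr ger0_norm // scale1r; lra.
have := bndB Ut U't x; rewrite U'E /U opprB addrC addrA subrK -scalerDr opZ.
rewrite rnorm_i opD -[Q x]scale1r.
rewrite -scalerDl (_ : 1 + 1 = (2 : R)%:C); last by rewrite rmorphD.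
rewrite rnormZr ger0_norm // scale1r; lra.
Qed.

Lemma sqr_one_sub S H : S + S = H + S * S -> (1 - S) * (1 - S) = 1 - H.
Proof.
move=> SH; rewrite mulrBl mul1r mulrBr mulr1 opprB.
have -> : H = S + S - S * S by rewrite SH addrK.
by rewrite opprB opprD !addrA [1 - S + _]addrAC.
Qed.

(** Positivity as a norm estimate: for real numbers, |t - T| <= t means
    0 <= T <= 2t. *)
Definition pos T := star T = T /\ exists2 t : R, 0 < t & bnd (t%:op - T) t.

Lemma pos_sa T : pos T -> star T = T.
Proof. by case. Qed.

Lemma star_sub_scal t T : star T = T -> star (t%:op - T) = t%:op - T.
Proof. by move=> sT; rewrite starB starZr opstar1 sT. Qed.

Lemma pos_scal_sub T t : star T = T -> 0 < t -> bnd T t -> pos (t%:op - T).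
Proof.
move=> sT t0 Tt; split; first exact: star_sub_scal.
by exists t => //; rewrite opprB addrC subrK.
Qed.

Lemma posD S T : pos S -> pos T -> pos (S + T).
Proof.
move=> [sS [s s0 Ss]] [sT [t t0 Tt]]; split; first by rewrite starD sS sT.
exists (s + t); first exact: addr_gt0.
by rewrite rmorphD scalerDl opprD addrACA; apply: bndD.
Qed.

Lemma pos_bdd T : pos T -> bdd T.
Proof.
move=> [_ [t t0 Tt]]; exists (t * 1 + t); first by rewrite mulr1 addr_ge0 ?ltW.
rewrite -[T](subKr t%:op); apply: bndB => //.
by apply: bndZ; [exact: ltW|exact: bnd1].
Qed.

Lemma pos_sqrt T : pos T ->
  exists V : adjop X,
    [/\ pos V, V * V = T & forall G, GRing.comm G T -> GRing.comm G V].
Proof.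
move=> [sT [t t0 Tt]]; 
pose H : adjop X := (t^-1)%:C *: (t%:op - T).
have HE : H = 1 - (t^-1)%:C *: T.
  by rewrite /H scalerBr scalerA -rmorphM mulVf ?gt_eqF // scale1r.
have H1 : bnd H 1.
  by rewrite -(mulVf (lt0r_neq0 t0)); apply: bndZ; rewrite ?invr_ge0 ?ltW.
have sH : star H = H by rewrite starZr star_sub_scal.
have [S [sS S1 SH _ SG]] := op_one_sub_sqrt CS sH H1.
have s0 : 0 < Num.sqrt t by rewrite sqrtr_gt0.
exists ((Num.sqrt t)%:op - (Num.sqrt t)%:C *: S); split.
- apply: pos_scal_sub => //; first by rewrite starZr sS.
  by rewrite -[X in bnd _ X]mulr1; apply: bndZ => //; exact: ltW.
- rewrite -scalerBr opZl opZr scalerA -rmorphM -expr2 sqr_sqrtr ?(ltW t0) //.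
  by rewrite (sqr_one_sub SH) HE subKr scalerA -rmorphM mulfV ?gt_eqF // scale1r.
- move=> G GT; rewrite -scalerBr; apply/commZ/commrB; first exact: commr1.
  by apply: SG; rewrite HE; apply: commrB; [exact: commr1|exact: commZ].
Qed.

(** For |K| <= 1 and Q = sqrt(1 - K^2), the operator K + iQ is an isometry.  So Q
    is a contraction, and so is 1 - K^2 = Q^2. *)
Lemma pos_sqr K : star K = K -> bdd K -> pos (K * K).
Proof.
move=> sK [t t0 Kt].
have [k k0 Kk] : exists2 k, 0 < k & bnd K k.
  by exists (t + 1); [rewrite ltr_wpDl|apply: bnd_le Kt; rewrite lerDl].
split; first by rewrite opstarM sK.
exists (k * k); first exact: mulr_gt0.
pose K1 : adjop X := (k^-1)%:C *: K.
have sK1 : star K1 = K1 by rewrite starZr sK.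
have K11 : bnd K1 1.
  by rewrite -(mulVf (lt0r_neq0 k0)); apply: bndZ; rewrite ?invr_ge0 ?ltW.
have -> : K * K = (k * k)%:C *: (K1 * K1).
  rewrite opZl opZr !scalerA -!rmorphM.
  by rewrite mulrAC mulfK ?gt_eqF // mulfV ?gt_eqF // scale1r.
rewrite -scalerBr -[X in bnd _ X]mulr1; apply: bndZ; first by rewrite mulr_ge0 ?ltW.
have sH : star (K1 * K1) = K1 * K1 by rewrite opstarM sK1.
have H1 : bnd (K1 * K1) 1 by rewrite -[X in bnd _ X]mulr1; apply: bndM.
have [S [sS S1 SH _ SG]] := op_one_sub_sqrt CS sH H1.
rewrite -(sqr_one_sub SH).
have sQ : star (1 - S) = 1 - S by rewrite starB opstar1 sS.
have KQ : GRing.comm K1 (1 - S).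
  by apply: commrB; [exact: commr1|apply/SG/commrM].
have [] := bnd_sqrD (t := 1) sK1 sQ KQ _ _ => //.
  by rewrite (sqr_one_sub SH) addrC subrK expr1n; exact: bnd1.
by move=> _ Q1; rewrite -[X in bnd _ X]mulr1; apply: bndM.
Qed.

(** With V = sqrt P, one has (V + iK)^* (V + iK) = P + K^2 = 0, so V = -iK;
    taking adjoints gives V = iK as well. *)
Lemma pos_add_sqr_eq0 P K : pos P -> star K = K -> P + K * K = 0 -> K = 0.
Proof.
move=> /pos_sqrt[V [pV VV VG]] sK PK0.
have KV : GRing.comm V K.
  apply/commr_sym/VG; rewrite (_ : P = - (K * K)); last first.
    by apply/eqP; rewrite -addr_eq0 PK0.
  exact/commrN/commrM.
have U0 : V + 'i%C *: K = 0.
  by apply: rip_rnorm0; rewrite op_sqrD ?VV //; exact: pos_sa.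
have : star (V + 'i%C *: K) = 0 by rewrite U0 star0.
rewrite starD starZ sK (pos_sa pV).
have -> : V = - ('i%C *: K) by apply/eqP; rewrite -addr_eq0 U0.
rewrite -scaleNr -scalerDl => /eqP; rewrite scaler_eq0.
have /negPf -> /= : - 'i%C + conjc 'i%C != 0 :> R[i].
  by rewrite eq_complex /=; apply/negP => /andP[_ /eqP]; lra.
by move/eqP.
Qed.

(** Both T^* T and T T^* are expressed through the real and imaginary parts of
    T, and the mixed terms cancel in their sum. *)
Lemma op_cartesian T :
  (T + star T) * (T + star T) + ('i%C *: (T - star T)) * ('i%C *: (T - star T))
    = (star T * T + T * star T) + (star T * T + T * star T).
Proof.
have -> : 'i%C *: (T - star T) * ('i%C *: (T - star T)) =
    - ((T - star T) * (T - star T)).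
  by rewrite opZl opZr scalerA -(expr2 ('i : R[i])%C) sqr_i scaleN1r.
rewrite mulrDl mulrBl !mulrDr !mulrN.
move: (T * T) (T * star T) (star T * T) (star T * star T) => p q r s.
rewrite !opprB [p + q]addrC [r - s + _]addrC addrACA.
by rewrite (addrACA q) (addrACA r) !subrr !addr0 addrACA (addrC q).
Qed.

(** T^* T is never a nonzero negative square.  For C = T W and r = T T^*, both
    C^* C = - W^4 and C C^* = - r^2 are negative, while twice their sum is a
    sum of squares by [op_cartesian]; so all these squares vanish. *)
Lemma sqr_neg_eq0 T W : bdd T -> bdd W -> star W = W ->
  star T * T = - (W * W) -> T = 0.
Proof.
move=> bT bW sW TW; pose C := T * W; pose r := T * star T.
have sr : star r = r by rewrite opstarM starK.
have bC : bdd C by exact: bddM.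
have br : bdd r by apply/bddM/bdd_star.
have CC : star C * C = - (W * W * (W * W)).
  by rewrite opstarM sW -mulrA [star T * _]mulrA TW mulNr mulrN !mulrA.
have CC' : C * star C = - (r * r).
  rewrite opstarM sW mulrA -(mulrA T) -[W * W]opprK -TW mulrN mulNr.
  by rewrite /r !mulrA.
have := op_cartesian C; rewrite CC CC'.
set PP := _ * _; set DD := _ * _.
have pP : pos PP.
  apply: pos_sqr; first by rewrite starD starK addrC.
  by apply/bddD/bdd_star.
have pD : pos DD.
  apply: pos_sqr; last by apply/bdd_i/bddB/bdd_star.
  rewrite starZ starB starK -opprB scalerN -scaleNr; congr (_ *: _).
  by simpc.
have pW : pos (W * W * (W * W)).
  by apply: pos_sqr; [rewrite opstarM sW|exact: bddM].
have pr := pos_sqr sr br.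
move=> sum0.
have r0 : r = 0.
  apply: pos_add_sqr_eq0 (posD (posD (posD pP pD) (posD pW pW)) pr) sr _.
  rewrite sum0 -!opprD (addrACA (W * W * (W * W))).
  by rewrite -!addrA addNr.
have : star T = 0 by apply: rip_rnorm0; rewrite starK.
by move/(congr1 star); rewrite starK star0.
Qed.

(** Kaplansky's argument.  Let h = T^* T, m = sqrt(h^2) (the absolute value of h)
    and g = m - h.  Then g h = - m g, so (T g)^* (T g) = g h g = - m g^2 is a
    negative square and T g = 0.  This forces g^2 = 0, hence h = m. *)
Lemma pos_star_mul T : bdd T -> pos (star T * T).
Proof.
move=> bT; pose h := star T * T.
have sh : star h = h by rewrite opstarM starK.
have bh : bdd h by apply/bddM/bT/bdd_star.
have [m [pm mm mG]] := pos_sqrt (pos_sqr sh bh).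
have hm : GRing.comm h m by apply/mG/commrM.
have [k [pk kk kG]] := pos_sqrt pm.
have mk : GRing.comm m k by exact: kG.
have hk : GRing.comm h k by exact: kG.
have [sm sk] := (pos_sa pm, pos_sa pk).
pose g := m - h.
have sg : star g = g by rewrite starB sm sh.
have gh : g * h = - (m * g).
  by rewrite mulrBl mulrBr mm opprB -hm.
have kg : GRing.comm k g by apply: commrB; apply: commr_sym.
pose w := g * k.
have sw : star w = w by rewrite opstarM sk sg kg.
have bg : bdd g by apply: bddB => //; exact: pos_bdd.
have Tg0 : T * g = 0.
  apply: (@sqr_neg_eq0 _ w) => //; first exact: bddM.
    by apply: bddM => //; exact: pos_bdd.
  rewrite opstarM sg -mulrA (mulrA (star T)) -/h mulrA gh mulNr -kk /w.
  by rewrite -[in RHS]kg -[in RHS]mulrA (mulrA g) -[in RHS]kg !mulrA.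
have gg : g * g = 0.
  have hg0 : h * g = 0 by rewrite -mulrA Tg0 mulr0.
  have gh0 : g * h = 0 by rewrite -[RHS](star0 (A := adjop X)) -hg0 opstarM sg sh.
  by rewrite {1}/g mulrBl hg0 subr0; apply/eqP; rewrite -oppr_eq0 -gh gh0.
have /eqP : g = 0 by apply: rip_rnorm0; rewrite sg.
by rewrite subr_eq0 -/h => /eqP <-.
Qed.

(** With K^2 = P and Y^2 = t - P, which is positive as the sum of t - (P + Q) and
    Q, one has K^2 + Y^2 = t. *)
Lemma bnd_pos_le P Q t : pos P -> pos Q -> 0 < t -> bnd (P + Q) t -> bnd P t.
Proof.
move=> pP pQ t0 PQt.
have [K [pK KK KG]] := pos_sqrt pP.
have pS : pos (t%:op - P).
  rewrite (_ : _ - P = t%:op - (P + Q) + Q); last by rewrite opprD addrA subrK.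
  apply: posD (pQ); apply: pos_scal_sub => //.
  by rewrite starD (pos_sa pP) (pos_sa pQ).
have [Y [pY YY YG]] := pos_sqrt pS.
have KY : GRing.comm K Y.
  apply: YG; apply: commrB; first exact/commZ/commr1.
  by rewrite -KK; apply: commrM.
have s0 : 0 <= Num.sqrt t by exact: sqrtr_ge0.
have [] := bnd_sqrD (pos_sa pK) (pos_sa pY) KY s0 _.
  rewrite KK YY addrC subrK sqr_sqrtr ?ltW // -[X in bnd _ X]mulr1.
  by apply: bndZ; [exact: ltW|exact: bnd1].
move=> Kt _; rewrite -KK -[X in bnd _ X]sqr_sqrtr ?ltW // expr2.
exact: bndM.
Qed.

End PositiveOperators.

(** * A C*-algebra as a Hilbert module over itself *)
Section SelfModule.
Context {R : realType}.

Definition selfmod (B : cstarAlgType R) : Type := B.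

Variable B : cstarAlgType R.
Implicit Types x y b : B.

HB.instance Definition _ := CompleteNormedModule.on (selfmod B).

Let self_ripDr x y z : star x ** (y + z) = star x ** y + star x ** z.
Proof. exact: smulDr. Qed.

Let self_ripZr (k : R[i]) x y : star x ** (k *: y) = k *: (star x ** y).
Proof. exact: smulZr. Qed.

Let self_rip_act x y b : star x ** (y ** b) = star x ** y ** b.
Proof. exact: smulA. Qed.

Let self_rip_star x y : star (star x ** y) = star y ** x.
Proof. by rewrite starM starK. Qed.

Let self_rip_pos x : cstar_pos (star x ** x).
Proof. by exists x. Qed.

Let self_norm x : `|x| = ip_norm (fun x y : B => star x ** y) x.
Proof. by rewrite /ip_norm cstar_identity sqrCK. Qed.

HB.instance Definition _ := isHilbertModule.Build R B (selfmod B)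
  (@smulDl R B) (@smulDr R B) (@smulZl R B) (fun k x b => smulZr k x b)
  (@smulA R B) self_ripDr self_ripZr self_rip_act self_rip_star self_rip_pos
  (@cstar_eq0 R B) self_norm.

End SelfModule.

Section Multiplication.
Context {R : realType} {B : cstarAlgType R}.
Implicit Types a b c : B.

Lemma self_cauchy_schwarz : @cauchy_schwarz R B (selfmod B).
Proof. by move=> x y; rewrite -(rnorm_star (x : B)) rnormM. Qed.

Fact lmul_subproof b :
  (smul b : selfmod B -> selfmod B) \in @adjointable R B (selfmod B).
Proof.
apply/adjointableP; exists (smul (star b)) => x y.
by rewrite /rip /= starM smulA.
Qed.

Definition lmul b : adjop (selfmod B) := Adjop (lmul_subproof b).

Lemma lmulE b (x : B) : lmul b x = b ** x. Proof. by []. Qed.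

Lemma lmulD a b : lmul (a + b) = lmul a + lmul b.
Proof. by apply: op_eqP => x; rewrite opD !lmulE smulDl. Qed.

Lemma lmulN b : lmul (- b) = - lmul b.
Proof. by apply: op_eqP => x; rewrite opN !lmulE smulNl. Qed.

Lemma lmulM a b : lmul (a ** b) = lmul a * lmul b.
Proof. by apply: op_eqP => x; rewrite opM !lmulE smulA. Qed.

Lemma lmulZ (k : R[i]) b : lmul (k *: b) = k *: lmul b.
Proof. by apply: op_eqP => x; rewrite opZ !lmulE smulZl. Qed.

Lemma lmul_star b : lmul (star b) = star (lmul b).
Proof. by apply/esym/adjop_star_eq => x y; rewrite /rip /= starM smulA. Qed.

Lemma bnd_lmul b : bnd (lmul b) (rnorm b).
Proof. by move=> x; exact: rnormM. Qed.

Lemma bdd_lmul b : bdd (lmul b).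
Proof. by exists (rnorm b); [exact: rnorm_ge0|exact: bnd_lmul]. Qed.

(** The multiplication operator attains the norm of [b] at its adjoint. *)
Lemma rnorm_lmul_le b (t : R) : 0 <= t -> bnd (lmul b) t -> rnorm b <= t.
Proof.
move=> t0 /(_ (star b : B)); rewrite lmulE rnorm_star.
rewrite -{1}[b]starK rnorm_cstar rnorm_star; exact: ler_sqr_cancel.
Qed.

Lemma lmul_inj : injective lmul.
Proof.
move=> a b ab; apply/eqP; rewrite -subr_eq0; apply/eqP/rnorm_le0.
by apply: rnorm_lmul_le => //; rewrite lmulD lmulN ab subrr; exact: bnd0.
Qed.

Definition bpos b := pos (lmul b).

Lemma bposD a b : bpos a -> bpos b -> bpos (a + b).
Proof. by rewrite /bpos lmulD; exact: posD. Qed.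

Lemma bpos_cstar b : bpos (star b ** b).
Proof.
rewrite /bpos lmulM lmul_star; apply: pos_star_mul (bdd_lmul b).
exact: self_cauchy_schwarz.
Qed.

Lemma cstar_pos_bpos b : cstar_pos b -> bpos b.
Proof. by move=> [c ->]; exact: bpos_cstar. Qed.

(** Transfer of [bnd_pos_le], which needs a positive bound: |a + b| may vanish,
    so all the numbers above it are used. *)
Lemma rnorm_bpos_le a b : bpos a -> bpos b -> rnorm a <= rnorm (a + b).
Proof.
move=> pa pb; apply/ler_addgt0Pr => e e0.
have t0 : 0 < rnorm (a + b) + e by rewrite ltr_wpDl ?rnorm_ge0.
apply: rnorm_lmul_le; first exact: ltW.
apply: (bnd_pos_le self_cauchy_schwarz pa pb t0).
by rewrite -lmulD; apply: bnd_le (bnd_lmul _); rewrite lerDl ltW.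
Qed.

(** Without a unit in [B], the square root 1 - s of 1 - h only makes sense as an
    operator; but s is a limit of polynomials in h without constant term, so it
    does belong to [B]. *)
Lemma cstar_one_sub_sqrt h : star h = h -> rnorm h <= 1 ->
  exists s : B, star s = s /\ s + s = h + s ** s.
Proof.
move=> sh h1; have H1 : bnd (lmul h) 1 by apply: bnd_le h1 (bnd_lmul h).
have sH : star (lmul h) = lmul h by rewrite -lmul_star sh.
have [S [sS _ SH Ss _]] := op_one_sub_sqrt self_cauchy_schwarz sH H1.
pose fix e n : B := if n is n'.+1 then (2^-1 : R)%:C *: (h + e n' ** e n') else 0.
have eE n : lmul (e n) = opseq (lmul h) n.
  elim: n => [|n IH] /=; last by rewrite lmulZ lmulD lmulM IH.
  by apply: op_eqP => x; rewrite lmulE smul0l.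
have [|m n nm|s se] := @rnorm_complete R B e sqgap.
- by move=> d d0; have [n] := sqgap_small 1 d0; rewrite mul1r; exists n.
- apply: rnorm_lmul_le; first exact: sqgap_ge0.
  rewrite lmulD lmulN !eE; apply: bnd_le (opseq_bnd_diff H1 nm).
  by rewrite lerD2r; case/andP: (@sqseq_itv R m).
have sE : lmul s = S.
  apply/eqP; rewrite -subr_eq0; apply/eqP/(@bnd_small _ _ _ _ 2) => n.
  rewrite -(subrKA (lmul (e n))) mulrDl mul1r; apply: bndD.
    by rewrite -lmulN -lmulD; apply: bnd_le (bnd_lmul _).
  by rewrite -opprB eE; apply: bndN.
exists s; split; apply: lmul_inj; first by rewrite lmul_star sE.
by rewrite !lmulD lmulM sE.
Qed.

End Multiplication.

(** * The Cauchy-Schwarz inequality *)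
Section CauchySchwarz.
Context {R : realType} {B : cstarAlgType R} {X : hilbertModType B}.
Implicit Types x y z : X.

Lemma bpos_rip x : bpos (rip x x).
Proof. exact/cstar_pos_bpos/rip_pos. Qed.

Lemma rip_sa x : star (rip x x) = rip x x. Proof. exact: rip_star. Qed.

Lemma ractBl x y (b : B) : ract (x - y) b = ract x b - ract y b.
Proof. by rewrite ractDl -scaleN1r ractZl scaleN1r. Qed.

Lemma ractBr x (b c : B) : ract x (b - c) = ract x b - ract x c.
Proof. by rewrite ractDr -scaleN1r ractZr scaleN1r. Qed.

(** Let w = <x,y> and z = y - x w.  Then <y,y> - <z,z> is
    2 w^* w - w^* <x,x> w = w^* w + w^* (1 - <x,x>) w, and 1 - <x,x> is a square. *)
Lemma rip_bessel x y : rnorm x <= 1 ->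
  exists v : B, rip y y = rip (y - ract x (rip x y)) (y - ract x (rip x y))
    + (star (rip x y) ** rip x y + star v ** v).
Proof.
move=> x1; have q1 : rnorm (rip x x) <= 1.
  by rewrite rnorm_rip expr_le1 ?rnorm_ge0.
have [s [ss sE]] := cstar_one_sub_sqrt (rip_sa x) q1.
set w := rip x y; exists (w - s ** w).
have -> : star (w - s ** w) ** (w - s ** w) = star w ** w - star w ** rip x x ** w.
  have -> : rip x x = s + s - s ** s by rewrite sE addrK.
  rewrite starB starM ss smulBl !smulBr smulDr smulDl !smulA.
  by rewrite smulNl smulDl -[LHS]addrA -opprD addrA.
rewrite ripBl !ripBr !rip_act !rip_actl -/w -[rip y x]rip_star -/w.
by rewrite -[_ - _ - _]addrA -opprD subrK.
Qed.

Lemma rip_cauchy_schwarz : @cauchy_schwarz R B X.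
Proof.
have CS1 x y : rnorm x <= 1 -> rnorm (rip x y) <= rnorm y.
  move=> /rip_bessel-/(_ y)[v yy].
  rewrite -(@ler_pXn2r _ 2) ?nnegrE ?rnorm_ge0 // -rnorm_cstar -rnorm_rip yy.
  rewrite addrA addrAC addrC; apply: rnorm_bpos_le; first exact: bpos_cstar.
  by apply: bposD; [exact: bpos_rip|exact: bpos_cstar].
move=> x y; have [->|x0] := eqVneq x 0; first by rewrite rip0l !rnorm0 mul0r.
have n0 := rnorm_gt0 x0.
have := CS1 ((rnorm x)^-1%:C *: x) y; rewrite rnorm_normalize // => /(_ (lexx 1)).
by rewrite ripZl conjc_real rnormZr ger0_norm ?invr_ge0 ?(ltW n0) // ler_pdivrMl.
Qed.

Lemma rnorm_sub_proj x y : rnorm x <= 1 ->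
  rnorm (y - ract x (rip x y)) <= rnorm y.
Proof.
move=> /rip_bessel-/(_ y)[v yy].
rewrite -(@ler_pXn2r _ 2) ?nnegrE ?rnorm_ge0 // -!rnorm_rip yy.
by apply: rnorm_bpos_le (bpos_rip _) (bposD _ _); exact: bpos_cstar.
Qed.

End CauchySchwarz.

(** * Homomorphisms into adjointable operators *)
Section StarHom.
Context {R : realType} {A B : cstarAlgType R} {X : hilbertModType B}.
Variables (phi : A -> adjop X) (phi_hom : star_hom phi).
Implicit Types (a b : A) (x y z : X).

Lemma homD a b : phi (a + b) = phi a + phi b. Proof. by case: phi_hom. Qed.
Lemma homZ (k : R[i]) a : phi (k *: a) = k *: phi a. Proof. by case: phi_hom. Qed.
Lemma homM a b : phi (a ** b) = phi a * phi b. Proof. by case: phi_hom. Qed.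
Lemma hom_star a : phi (star a) = star (phi a). Proof. by case: phi_hom. Qed.

Lemma homN a : phi (- a) = - phi a.
Proof. by rewrite -scaleN1r homZ scaleN1r. Qed.

Lemma homB a b : phi (a - b) = phi a - phi b.
Proof. by rewrite homD homN. Qed.

Lemma hom0 : phi 0 = 0.
Proof. by rewrite -(subrr (0 : A)) homB subrr. Qed.

(** For |a| <= 1, writing a^* a = 2 s - s^2 gives
    <x,x> - <phi(a) x, phi(a) x> = <(1 - phi(s)) x, (1 - phi(s)) x>. *)
Lemma star_hom_contractive a : bnd (phi a) (rnorm a).
Proof.
have contr1 b x : rnorm b <= 1 -> rnorm (phi b x) <= rnorm x.
  move=> b1; have h1 : rnorm (star b ** b) <= 1.
    by rewrite rnorm_cstar expr_le1 ?rnorm_ge0.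
  have [s [ss sE]] := cstar_one_sub_sqrt (star_sqr b) h1.
  have SE : phi s + phi s = phi (star b ** b) + phi s * phi s.
    by rewrite -homM -!homD sE.
  have sS : star (1 - phi s) = 1 - phi s by rewrite starB opstar1 -hom_star ss.
  rewrite -(@ler_pXn2r _ 2) ?nnegrE ?rnorm_ge0 // -!rnorm_rip.
  have -> : rip x x = rip (phi b x) (phi b x) +
                      rip ((1 - phi s) x) ((1 - phi s) x).
    rewrite !rip_op sS -!opM (sqr_one_sub SE) -hom_star -homM -ripDr opB addrC.
    by rewrite subrK.
  by apply: rnorm_bpos_le; exact: bpos_rip.
move=> x; have [->|a0] := eqVneq a 0.
  by rewrite hom0 op0 !rnorm0 mul0r.
have n0 := rnorm_gt0 a0.
have := contr1 ((rnorm a)^-1%:C *: a) x.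
rewrite rnorm_normalize // => /(_ (lexx 1)).
by rewrite homZ opZ rnormZr ger0_norm ?invr_ge0 ?(ltW n0) // ler_pdivrMl.
Qed.

Lemma rank_oneE x y z : rank_one x y z = ract x (rip y z). Proof. by []. Qed.

Lemma rank_oneDl x x' y : rank_one (x + x') y = rank_one x y + rank_one x' y.
Proof. by apply: op_eqP => z; rewrite opD !rank_oneE ractDl. Qed.

Lemma rank_oneZl (k : R[i]) x y : rank_one (k *: x) y = k *: rank_one x y.
Proof. by apply: op_eqP => z; rewrite opZ !rank_oneE ractZl. Qed.

Lemma rank_oneBl x x' y : rank_one (x - x') y = rank_one x y - rank_one x' y.
Proof. by rewrite rank_oneDl -scaleN1r rank_oneZl scaleN1r. Qed.

Lemma op_rank_one (T : adjop X) x y : T * rank_one x y = rank_one (T x) y.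
Proof.
apply: op_eqP => z; apply: rip_injr => w; rewrite opM !rank_oneE.
by rewrite rip_opr !rip_act rip_op starK.
Qed.

Lemma rank_one_star x y : star (rank_one x y) = rank_one y x.
Proof.
by apply: adjop_star_eq => z w /=; rewrite rip_actl rip_act rip_star.
Qed.

Lemma rank_one_ract x y (b : B) :
  rank_one (ract x b) y = rank_one x (ract y (star b)).
Proof. by apply: op_eqP => z; rewrite !rank_oneE rip_actl starK ractM. Qed.

End StarHom.

(** * Inner products that make a correspondence a bimodule *)
Section BimoduleInnerProduct.
Context {R : realType} {A B : cstarAlgType R} {X : hilbertModType B}.
Variables (phi : A -> adjop X) (phi_hom : star_hom phi).
Implicit Types (a b : A) (x y z : X) (ip : X -> X -> A).

(** The bimodule axioms that are algebraic or concern the order, without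
    completeness: [bimodule_ip_norm] shows that the norm of such an inner product
    is the given norm of the module, which is complete. *)
Record bimodule_ip ip : Prop := BimoduleIp {
  ipDl : forall x y z, ip (x + y) z = ip x z + ip y z;
  ipZl : forall (k : R[i]) x y, ip (k *: x) y = k *: ip x y;
  ip_act : forall a x y, ip (phi a x) y = a ** ip x y;
  ip_star : forall x y, star (ip x y) = ip y x;
  ip_pos : forall x, bpos (ip x x);
  ip_hom : forall x y, phi (ip x y) = rank_one x y
}.

Lemma hilbert_bimodule_ip ip :
  hilbert_bimodule (fun a x => phi a x) ip -> bimodule_ip ip.
Proof.
move=> [[_ _ _ _ _ D Z act st ps _ _] rk].
split=> // [x|x y]; first exact: cstar_pos_bpos.
by apply: op_eqP => z; rewrite rk.
Qed.

(** The difference d of two values satisfies phi d = 0, so d annihilates the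
    values of both inner products on the left, its own adjoint included. *)
Lemma bimodule_ip_uniq ip ip' : bimodule_ip ip -> bimodule_ip ip' -> ip = ip'.
Proof.
move=> I I'; apply/funext => x; apply/funext => y.
apply/eqP; rewrite -subr_eq0; apply/eqP; set d := _ - _.
have d0 : phi d = 0 by rewrite homB // (ip_hom I) (ip_hom I') subrr.
have dip z w : d ** ip z w = 0.
  by rewrite -(ip_act I) d0 op0 -(scale0r (0 : X)) (ipZl I) scale0r.
have dip' z w : d ** ip' z w = 0.
  by rewrite -(ip_act I') d0 op0 -(scale0r (0 : X)) (ipZl I') scale0r.
have : star d = 0.
  apply: cstar_eq0; rewrite starK {2}/d starB (ip_star I) (ip_star I').
  by rewrite smulBr dip dip' subrr.
by move/(congr1 star); rewrite starK star0.
Qed.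

Section Theory.
Variables (ip : X -> X -> A) (I : bimodule_ip ip).

Lemma ip0l y : ip 0 y = 0.
Proof. by rewrite -(scale0r (0 : X)) (ipZl I) scale0r. Qed.

Lemma ipDr x y z : ip x (y + z) = ip x y + ip x z.
Proof. by rewrite -(ip_star I) (ipDl I) starD !(ip_star I). Qed.

Lemma ipZr (k : R[i]) x y : ip x (k *: y) = conjc k *: ip x y.
Proof. by rewrite -(ip_star I) (ipZl I) starZ (ip_star I). Qed.

Lemma ipNl x y : ip (- x) y = - ip x y.
Proof. by rewrite -scaleN1r (ipZl I) scaleN1r. Qed.

Lemma ipNr x y : ip x (- y) = - ip x y.
Proof. by rewrite -(ip_star I) ipNl starN (ip_star I). Qed.

Lemma hom0_ip d x y : phi d = 0 -> d ** ip x y = 0.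
Proof. by move=> d0; rewrite -(ip_act I) d0 ip0l. Qed.

(** Both sides have the same image under phi.  As phi need not be injective, the
    equality comes from the fact that their difference kills its own adjoint. *)
Lemma ip_ract x y (b : B) : ip (ract x b) y = ip x (ract y (star b)).
Proof.
apply/eqP; rewrite -subr_eq0; apply/eqP; set d := _ - _.
have d0 : phi d = 0 by rewrite homB // !(ip_hom I) rank_one_ract subrr.
have : star d = 0.
  apply: cstar_eq0; rewrite starK {2}/d starB !(ip_star I) smulBr.
  by rewrite !hom0_ip // subrr.
by move/(congr1 star); rewrite starK star0.
Qed.

(** For <x,x> = 2 s - s^2, the elements ip(y,x) ip(x,y) = ip(y <x,x>, y) and
    ip(y - y s, y - y s) add up to ip(y,y), by [ip_ract]. *)
Lemma ip_sqr_le x y : rnorm x <= 1 -> rnorm (ip x y) ^+ 2 <= rnorm (ip y y).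
Proof.
move=> x1; have q1 : rnorm (rip x x) <= 1.
  by rewrite rnorm_rip expr_le1 ?rnorm_ge0.
have [s [ss sE]] := cstar_one_sub_sqrt (rip_sa x) q1.
have -> : ip y y = star (ip x y) ** ip x y + ip (y - ract y s) (y - ract y s).
  have -> : star (ip x y) ** ip x y = ip (ract y (rip x x)) y.
    by rewrite (ip_star I) -(ip_act I) (ip_hom I).
  have ip_s z : ip z (ract y s) = ip (ract z s) y by rewrite ip_ract ss.
  rewrite ipDr ipNr ip_s -ipNl -!(ipDl I); congr (ip _ _).
  rewrite (_ : rip x x = s + s - s ** s); last by rewrite sE addrK.
  rewrite ractBl ractBr ractDr ractM -[y - _ - _]addrA -opprD.
  by rewrite [ract y s + (_ - _)]addrA [RHS]addrC subrK.
by rewrite -rnorm_cstar; apply: rnorm_bpos_le; [exact: bpos_cstar|exact: ip_pos].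
Qed.

Lemma rnorm_ip_le x y : rnorm (ip x y) <= rnorm x * rnorm y.
Proof.
have self1 z : rnorm z <= 1 -> rnorm (ip z z) <= 1.
  by move=> /(ip_sqr_le z); have := rnorm_ge0 (ip z z); nra.
have le1 z w : rnorm z <= 1 -> rnorm w <= 1 -> rnorm (ip z w) <= 1.
  by move=> /(ip_sqr_le w) zw /self1; have := rnorm_ge0 (ip z w); nra.
have [->|x0] := eqVneq x 0; first by rewrite ip0l !rnorm0 mul0r.
have [->|y0] := eqVneq y 0.
  by rewrite -(ip_star I) ip0l star0 !rnorm0 mulr0.
have := le1 ((rnorm x)^-1%:C *: x) ((rnorm y)^-1%:C *: y).
rewrite !rnorm_normalize // => /(_ (lexx 1) (lexx 1)).
have [nx ny] := (rnorm_gt0 x0, rnorm_gt0 y0).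
rewrite (ipZl I) ipZr conjc_real !rnormZr !ger0_norm ?invr_ge0 ?(ltW nx) ?(ltW ny) //.
by rewrite mulrA -invfM ler_pdivrMl ?mulr_gt0 // mulr1.
Qed.

(** The lower bound comes from ip(x,x) x = x <x,x>, a vector of norm |x|^3, and
    the contractivity of phi. *)
Lemma rnorm_ip x : rnorm (ip x x) = rnorm x ^+ 2.
Proof.
apply/eqP; rewrite eq_le {1}expr2 rnorm_ip_le /=.
have [->|x0] := eqVneq x 0; first by rewrite rnorm0 expr0n rnorm_ge0.
have nx := rnorm_gt0 x0.
have := star_hom_contractive phi_hom (ip x x) x.
rewrite (ip_hom I) rank_oneE; set q := rip x x.
have qE : rnorm q = rnorm x ^+ 2 by exact: rnorm_rip.
have sq : star q = q by exact: rip_sa.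
have : rnorm q ^+ 4 <= rnorm (ract x q) ^+ 2 * rnorm q.
  rewrite -[rnorm (ract x q) ^+ 2]rnorm_rip rip_act rip_actl sq.
  rewrite (exprM _ 2 2) -(rnorm_sqr_sa sq) -rnorm_sqr_sa ?starM ?sq //.
  by rewrite smulA; exact: rnormM.
rewrite qE; have := rnorm_ge0 (ract x q); have := rnorm_ge0 (ip x x).
move: (rnorm x) nx (rnorm (ract _ _)) (rnorm (ip _ _)) => n n0 r i i0 r0.
move=> nr rin.
have rr : r ^+ 2 <= (i * n) ^+ 2 by rewrite ler_pXn2r ?nnegrE ?mulr_ge0 ?(ltW n0).
rewrite -(@ler_pXn2r _ 2) ?nnegrE ?exprn_ge0 ?(ltW n0) //.
rewrite -(ler_pM2r (exprn_gt0 4 n0)).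
have -> : (n ^+ 2) ^+ 2 * n ^+ 4 = (n ^+ 2) ^+ 4 by ring.
have -> : i ^+ 2 * n ^+ 4 = (i * n) ^+ 2 * n ^+ 2 by ring.
by apply: (le_trans nr); rewrite ler_wpM2r ?exprn_ge0 // ltW.
Qed.
Lemma bimodule_ip_norm : ip_norm ip = (fun x => `|x|).
Proof.
apply/funext => x; rewrite hilbert_norm /ip_norm !rnormE.
by rewrite rnorm_ip rnorm_rip.
Qed.

End Theory.

End BimoduleInnerProduct.

(** * Compact operators *)
Section Closure.
Context {R : realType} {V : normedModType R[i]}.

Lemma closure_rnormP (S : set V) (x : V) :
  closure S x <-> forall e : R, 0 < e -> exists2 y, S y & rnorm (x - y) < e.
Proof.
have ballE (y : V) (e : R) : ball x e%:C y <-> rnorm (x - y) < e.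
  by rewrite -ball_normE /ball_/= rnormE ltcR.
split=> [Sx e e0|Sx U /nbhs_ballP[_ /= /posC_Re[e e0 ->] xU]].
  have [|y [Sy xy]] := Sx (ball x e%:C); first by apply: nbhsx_ballx; rewrite ltcR.
  by exists y => //; apply/ballE.
by have [y Sy xy] := Sx _ e0; exists y; split=> //; apply/xU/ballE.
Qed.

End Closure.

Section CompactOperators.
Context {R : realType} {B : cstarAlgType R} {X : hilbertModType B}.
Implicit Types (x y z : X) (T : adjop X) (t e : R) (s : seq (X * X)).

Lemma opnorm_le T t : 0 <= t -> bnd T t -> (opnorm T <= t%:E)%E.
Proof.
move=> t0 Tt; apply/ereal_supP => _ [x /= x1 <-]; rewrite lee_fin.
apply: le_trans (Tt x) _; rewrite ler_piMr //.
by move: x1; rewrite rnormE lecR.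
Qed.

Lemma opnorm_lt_bnd T t : (opnorm T < t%:E)%E -> bnd T t.
Proof.
move=> Tt x; have [->|x0] := eqVneq x 0; first by rewrite opx0 !rnorm0 mulr0.
have nx := rnorm_gt0 x0; set x1 : X := (rnorm x)^-1%:C *: x.
have : ((rnorm (T x1))%:E <= opnorm T)%E.
  apply: ereal_sup_ubound; exists x1 => //=.
  by rewrite rnormE lecR rnorm_normalize.
move=> /le_lt_trans/(_ Tt); rewrite lte_fin /x1 adjopZ rnormZr.
by rewrite ger0_norm ?invr_ge0 ?(ltW nx) // mulrC ltr_pdivrMr // => /ltW.
Qed.

(** Coefficients are absorbed in the first vector of each pair. *)
Definition rank_sum s : adjop X := \sum_(p <- s) rank_one p.1 p.2.

Lemma rank_one_spanP T : rank_one_span X T <-> exists s, T = rank_sum s.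
Proof.
split=> [[n [c [x [y ->]]]]|[s ->]].
  exists [seq (c i *: x i, y i) | i <- enum 'I_n]; rewrite /rank_sum big_map big_enum.
  by apply: eq_bigr => i _; rewrite rank_oneZl.
exists (size s), (fun=> 1), (fun i => (tnth (in_tuple s) i).1),
  (fun i => (tnth (in_tuple s) i).2).
by rewrite /rank_sum big_tnth; apply: eq_bigr => i _; rewrite scale1r.
Qed.

Lemma compact_opsP T :
  compact_ops X T <-> forall e, 0 < e -> exists s, bnd (T - rank_sum s) e.
Proof.
split=> Tc e e0.
  have [S /rank_one_spanP[s ->] /opnorm_lt_bnd ?] := Tc _ e0.
  by exists s.
have e20 : 0 < e / 2 by rewrite divr_gt0.
have [s Ts] := Tc _ e20; exists (rank_sum s); first by apply/rank_one_spanP; exists s.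
apply: le_lt_trans (opnorm_le (ltW e20) Ts) _.
by rewrite lte_fin ltr_pdivrMr // ltr_pMr // ltr1n.
Qed.

Lemma rank_sum1 x y : rank_sum [:: (x, y)] = rank_one x y.
Proof. by rewrite /rank_sum big_seq1. Qed.

Lemma compact_rank_one x y : compact_ops X (rank_one x y).
Proof.
apply/compact_opsP => e e0; exists [:: (x, y)]; rewrite rank_sum1 subrr.
exact: bnd_le (ltW e0) bnd0.
Qed.

(** Let T = theta_(x,x), a positive contraction.  Its square root is the limit of
    the polynomials 1 - s_n in T, where s_n is the iteration started from 1 - T.
    The constant term of 1 - s_n is the scalar gap, which tends to 0, and the
    rest has the form theta_(z,x).  So sqrt T is a limit of rank-one operators. *)
Lemma rank_one_sqrt x : rnorm x <= 1 -> exists V : adjop X,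
  [/\ star V = V, V * V = rank_one x x & compact_ops X V].
Proof.
move=> x1; set T := rank_one x x; pose H : adjop X := 1 - T.
have H1 : bnd H 1 by move=> y; rewrite mul1r; exact: rnorm_sub_proj.
have sH : star H = H by rewrite starB opstar1 rank_one_star.
have [S [sS _ SH Sseq _]] := op_one_sub_sqrt rip_cauchy_schwarz sH H1.
have seqE n : exists z, opseq H n = (sqseq n)%:op - rank_one z x.
  elim: n => [|n [z IH]].
    exists 0; rewrite /= rmorph0 scale0r sub0r; apply/esym/eqP.
    by rewrite oppr_eq0 -(scale0r (0 : X)) rank_oneZl scale0r.
  set k := rank_one z x in IH *.
  (* theta_(z,x)^2 = theta_(k z,x) for k = theta_(z,x) *)
  exists ((2^-1 : R)%:C *: (x + (sqseq n)%:C *: z + (sqseq n)%:C *: z - k z)).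
  rewrite rank_oneZl rank_oneBl !rank_oneDl rank_oneZl -op_rank_one -/T -/k.
  rewrite /= IH rmorphM rmorphD rmorphM -scalerA -scalerBr; congr (_ *: _).
  rewrite mulrBl !mulrBr !(opZl, opZr) !mul1r !mulr1 scalerA scalerDl scale1r.
  by rewrite /H !opprD !opprK !addrA [1 - T + _]addrAC.
exists (1 - S); split; first by rewrite starB opstar1 sS.
  by rewrite (sqr_one_sub SH) subKr.
apply/compact_opsP => e e0; have [n gap_e] := sqgap_small 2 e0.
have [z nz] := seqE n; exists [:: (z, x)]; rewrite rank_sum1.
have -> : 1 - S - rank_one z x = (sqgap n)%:op - (S - opseq H n).
  by rewrite nz rmorphB scalerBl scale1r opprB !addrA subrK addrAC.
apply: bnd_le (ltW gap_e) _; rewrite mulrDl mul1r; apply: bndB => //.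
by rewrite -[X in bnd _ X]mulr1; apply: bndZ; [exact: sqgap_ge0|exact: bnd1].
Qed.

End CompactOperators.

(** * From an ideal to a bimodule *)

Lemma norm_complete_normr (R : realType) (V : completeNormedModType R[i]) :
  norm_complete (fun x : V => `|x|).
Proof.
move=> u u_cauchy.
have /cauchy_cvgP/cvg_ex[l ul] : cauchy (u @ \oo).
  apply: cauchy_exP => e e0; have [N uN] := u_cauchy e e0.
  exists (u N), N => // m /= Nm.
  by rewrite -ball_normE /ball_/=; apply: uN.
exists l => e e0; have /cvgrPdist_lt/(_ e e0)[N _ Nl] := ul.
by exists N => n /Nl/=; rewrite distrC.
Qed.

Section IdealToBimodule.
Context {R : realType} {A B : cstarAlgType R} {X : hilbertModType B}.
Variables (phi : A -> adjop X) (phi_hom : star_hom phi).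
Variable J : set A.
Hypotheses (J_ideal : cstar_ideal J) (phi_bij : set_bij J (compact_ops X) phi).
Implicit Types (a b : A) (x y z : X).

Let J0 : J 0. Proof. by case: J_ideal. Qed.
Let JD a b : J a -> J b -> J (a + b).
Proof. by case: J_ideal => _ _ JD _ _; exact: JD. Qed.
Let JZ (k : R[i]) a : J a -> J (k *: a).
Proof. by case: J_ideal => _ _ _ JZ _; exact: JZ. Qed.
Let JMl a b : J b -> J (a ** b).
Proof. by case: J_ideal => _ _ _ _ JM /(JM a)[]. Qed.
Let JMr a b : J b -> J (b ** a).
Proof. by case: J_ideal => _ _ _ _ JM /(JM a)[]. Qed.

Let phi_inj a b : J a -> J b -> phi a = phi b -> a = b.
Proof. by case: phi_bij => _ inj _ Ja Jb; apply: inj; rewrite inE. Qed.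

Let phi_eq0 a : J a -> phi a = 0 -> a = 0.
Proof. by move=> Ja a0; apply: phi_inj => //; rewrite hom0. Qed.

(** The ideal J is closed under adjoints as soon as its image is.  For
    d = a^* - b, the products a d and d^* b lie in J and in the kernel of phi, so
    they vanish, and d^* d = (a d)^* - d^* b = 0. *)
Lemma ideal_star_eq a b : J a -> J b -> phi b = star (phi a) -> b = star a.
Proof.
move=> Ja Jb ab; apply/esym/eqP; rewrite -subr_eq0; apply/eqP/cstar_eq0.
set d := star a - b; have d0 : phi d = 0 by rewrite homB // hom_star // ab subrr.
have sd0 : phi (star d) = 0 by rewrite hom_star // d0 star0.
rewrite {2}/d smulBr -starM.
have -> : a ** d = 0 by apply: phi_eq0; [exact: JMr|rewrite homM // d0 mulr0].
have -> : star d ** b = 0 by apply: phi_eq0; [exact: JMl|rewrite homM // sd0 mul0r].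
by rewrite star0 subrr.
Qed.

Lemma ideal_bimodule_ip : exists ip,
  [/\ bimodule_ip phi ip, forall x, cstar_pos (ip x x)
    & forall x, ip x x = 0 -> x = 0].
Proof.
have /choice[ip' ipP] : forall p : X * X, exists a, J a /\ phi a = rank_one p.1 p.2.
  move=> [x y]; case: phi_bij => _ _ /(_ _ (compact_rank_one x y))[a Ja phia].
  by exists a.
pose ip x y := ip' (x, y).
have Jip x y : J (ip x y) by case: (ipP (x, y)).
have phi_ip x y : phi (ip x y) = rank_one x y by case: (ipP (x, y)).
have ipZl k x y : ip (k *: x) y = k *: ip x y.
  by apply: phi_inj => //; [exact: JZ|rewrite homZ // !phi_ip rank_oneZl].
have ip_star x y : star (ip x y) = ip y x.
  by apply/esym/ideal_star_eq => //; rewrite !phi_ip rank_one_star.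
have ippos x : cstar_pos (ip x x).
  have pos1 z : rnorm z <= 1 -> cstar_pos (ip z z).
    move=> /rank_one_sqrt[V [sV VV Vc]].
    case: phi_bij => _ _ /(_ _ Vc)[b Jb phib]; exists b.
    apply: phi_inj => //; first exact: JMl.
    by rewrite phi_ip homM // hom_star // phib sV VV.
  have [->|x0] := eqVneq x 0; first by apply: pos1; rewrite rnorm0.
  have [|b bE] := pos1 ((rnorm x)^-1%:C *: x); first by rewrite rnorm_normalize.
  exists ((rnorm x)%:C *: b).
  rewrite starZr smulZl smulZr -bE ipZl -[ip x (_ *: x)]ip_star ipZl starZr ip_star.
  rewrite !scalerA -!rmorphM /=.
  by rewrite mulrAC !mulfK ?mulfV ?scale1r // gt_eqF // rnorm_gt0.
exists ip; split=> // [|x ip0]; last first.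
  have := phi_ip x x; rewrite ip0 hom0 // => /(congr1 (fun T : adjop X => T x)).
  rewrite op0 rank_oneE => /esym xq; apply/rip_eq0/cstar_eq0.
  by rewrite rip_sa -rip_act xq rip0r.
split=> // [x y z|a x y|x].
- by apply: phi_inj => //; [exact: JD|rewrite homD // !phi_ip rank_oneDl].
- by apply: phi_inj => //; [exact: JMl|rewrite homM // !phi_ip op_rank_one].
- exact: cstar_pos_bpos.
Qed.

Lemma ideal_bimodule :
  exists! ip : X -> X -> A, hilbert_bimodule (fun a x => phi a x) ip.
Proof.
have [ip [I ippos ip0]] := ideal_bimodule_ip; exists ip; split; last first.
  by move=> ip' /hilbert_bimodule_ip; exact: bimodule_ip_uniq.
split=> [|x y z]; last by rewrite (ip_hom I).
split=> //.
- by move=> a b x; rewrite homD.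
- by move=> a x y; rewrite adjopD.
- by move=> k a x; rewrite homZ.
- by move=> k a x; rewrite adjopZ.
- by move=> a b x; rewrite homM.
- exact: ipDl I.
- exact: ipZl I.
- exact: ip_act I.
- exact: ip_star I.
- by rewrite (bimodule_ip_norm phi_hom I); exact: norm_complete_normr.
Qed.

End IdealToBimodule.

(** * From a bimodule to an ideal *)

Lemma geometric_le (R : realType) (r t C : R) : 0 <= r -> 0 <= t ->
  (forall n, r ^+ n.+2 <= t ^+ n.+1 * C) -> r <= t.
Proof.
move=> r0 t0 rC; rewrite leNgt; apply/negP => tr.
have rpos : 0 < r by exact: le_lt_trans tr.
pose q := t / r; have q0 : 0 <= q by rewrite divr_ge0.
have q1 : `|q| < 1 by rewrite ger0_norm // ltr_pdivrMr // mul1r.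
have rqC n : r <= q ^+ n.+1 * C.
  rewrite -(ler_pM2l (exprn_gt0 n.+1 rpos)) -exprSr mulrA -exprMn.
  by rewrite /q mulrCA mulfV ?gt_eqF // mulr1.
have C0 : 0 < C.
  rewrite ltNge; apply/negP => C0; have := rqC 0%N.
  by rewrite leNgt (le_lt_trans _ rpos) // mulr_ge0_le0 // exprn_ge0.
have /cvgrPdist_lt/(_ (r / C) (divr_gt0 rpos C0))[N _ /(_ N.+1 (leqnSn N))/=] :=
  cvg_expr q1.
by rewrite sub0r normrN ger0_norm ?exprn_ge0 // ltr_pdivlMr // ltNge rqC.
Qed.

Section BimoduleToIdeal.
Context {R : realType} {A B : cstarAlgType R} {X : hilbertModType B}.
Variables (phi : A -> adjop X) (phi_hom : star_hom phi).
Variables (ip : X -> X -> A) (I : bimodule_ip phi ip).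
Implicit Types (a b c g : A) (x y z : X) (s : seq (X * X)) (t e : R).

Definition ip_sum s : A := \sum_(p <- s) ip p.1 p.2.

Lemma ip_sum_hom s : phi (ip_sum s) = rank_sum s.
Proof.
rewrite (big_morph phi (homD phi_hom) (hom0 phi_hom)).
by apply: eq_bigr => p _; rewrite (ip_hom I).
Qed.

Lemma ip_sumD s s' : ip_sum s + ip_sum s' = ip_sum (s ++ s').
Proof. by rewrite /ip_sum big_cat. Qed.

Lemma ip_sumZ (k : R[i]) s :
  k *: ip_sum s = ip_sum [seq (k *: p.1, p.2) | p <- s].
Proof.
rewrite /ip_sum big_map scaler_sumr.
by apply: eq_bigr => p _; rewrite (ipZl I).
Qed.

Lemma ip_sumN s : exists s', - ip_sum s = ip_sum s'.
Proof. by eexists; rewrite -scaleN1r ip_sumZ. Qed.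

Lemma smul_ip_sum a s : a ** ip_sum s = ip_sum [seq (phi a p.1, p.2) | p <- s].
Proof.
rewrite /ip_sum big_map (big_morph (smul a) (smulDr a) (smul0r a)).
by apply: eq_bigr => p _; rewrite (ip_act I).
Qed.

Lemma star_ip_sum s : star (ip_sum s) = ip_sum [seq (p.2, p.1) | p <- s].
Proof.
rewrite /ip_sum big_map (big_morph (@star R A) (@starD R A) (@star0 R A)).
by apply: eq_bigr => p _; rewrite (ip_star I).
Qed.

Lemma ip_sum_smul a s : exists s', ip_sum s ** a = ip_sum s'.
Proof.
by eexists; rewrite -[LHS]starK starM star_ip_sum smul_ip_sum star_ip_sum.
Qed.

(** Left multiples of a fixed finite sum are controlled by phi, as
    g ip(x,y) = ip(phi(g) x, y).  The constant depends on the sum; the power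
    trick of [ip_sum_isometric] removes it. *)
Lemma smul_ip_sum_le s : exists C, forall g t, bnd (phi g) t ->
  rnorm (g ** ip_sum s) <= t * C.
Proof.
exists (\sum_(p <- s) rnorm p.1 * rnorm p.2) => g t gt.
rewrite smul_ip_sum /ip_sum big_map; elim: s => [|p s IH].
  by rewrite !big_nil rnorm0 mulr0.
rewrite !big_cons mulrDr; apply: le_trans (ler_rnormD _ _) _; apply: lerD => //.
apply: le_trans (rnorm_ip_le phi_hom I _ _) _ => /=.
by rewrite mulrA ler_wpM2r ?rnorm_ge0.
Qed.

(** This is a^(n+1): in an algebra without unit there is no a^0. *)
Fixpoint spow a n : A := if n is n'.+1 then a ** spow a n' else a.

Lemma spow_sa a n : star a = a ->
  star (spow a n) = spow a n /\ spow a n ** a = a ** spow a n.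
Proof.
move=> sa; elim: n => [|n [IH IHa]] //=.
by split; [rewrite starM IH sa IHa|rewrite -smulA IHa].
Qed.

(** The lower bound follows from the log-convexity
    |a^n|^2 = |a^(2n)| <= |a^(n-1)| |a^(n+1)|. *)
Lemma rnorm_spow a n : star a = a -> rnorm (spow a n) = rnorm a ^+ n.+1.
Proof.
move=> sa; have le m : rnorm (spow a m.+1) <= rnorm a * rnorm (spow a m).
  exact: rnormM.
suff [] : rnorm (spow a n) = rnorm a ^+ n.+1 /\
          rnorm (spow a n.+1) = rnorm a ^+ n.+2 by [].
elim: n => [|n [IH IH1]]; first by rewrite expr1 -rnorm_sqr_sa.
split=> //; apply/eqP; rewrite eq_le exprS -IH1 le /=.
have [a0|a0] := eqVneq (rnorm a) 0; first by rewrite a0 mul0r rnorm_ge0.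
have apos : 0 < rnorm a by rewrite lt_def a0 rnorm_ge0.
rewrite -(ler_pM2l (exprn_gt0 n.+1 apos)) -{1}IH.
have -> : rnorm (spow a n) * (rnorm a * rnorm (spow a n.+1)) =
    rnorm (spow a n.+1) ^+ 2.
  by rewrite IH IH1 (exprS _ n.+1); ring.
have [sn _] := spow_sa n.+1 sa; rewrite -(rnorm_sqr_sa sn) -IH.
have [_ an] := spow_sa n sa.
rewrite (_ : _ ** _ = spow a n ** spow a n.+2); first exact: rnormM.
by rewrite /= -{1}an -smulA.
Qed.

Lemma bnd_spow a t n : 0 <= t -> bnd (phi a) t -> bnd (phi (spow a n)) (t ^+ n.+1).
Proof.
move=> t0 phi_at; elim: n => [|n IH] //=.
by rewrite homM // exprS; apply: bndM.
Qed.

(** Let h = a a^*.  Since h is again a finite sum, |h|^(n+2) = |h^(n+1) h| is at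
    most C |phi(h)|^(n+1) for a constant C, and letting n grow gives
    |h| <= |phi(h)|. *)
Lemma ip_sum_isometric s t : 0 <= t -> bnd (rank_sum s) t -> rnorm (ip_sum s) <= t.
Proof.
move=> t0; rewrite -ip_sum_hom; set a := ip_sum s => phi_at.
pose h := a ** star a.
have sh : star h = h by rewrite starM starK.
have ht : bnd (phi h) (t ^+ 2).
  rewrite homM // hom_star // expr2; apply: bndM => //.
  exact: (bnd_star rip_cauchy_schwarz t0 phi_at).
have [s' hs'] : exists s', h = ip_sum s' by exact: ip_sum_smul.
have [C hC] := smul_ip_sum_le s'.
rewrite -(@ler_pXn2r _ 2) ?nnegrE ?rnorm_ge0 //.
rewrite -[rnorm a]rnorm_star -rnorm_cstar starK -/h.
apply: (@geometric_le _ _ _ C); rewrite ?rnorm_ge0 ?exprn_ge0 // => n.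
have [_ hn] := spow_sa n sh.
rewrite -rnorm_spow // [spow h n.+1]/= -hn {2}hs'.
exact/hC/bnd_spow/ht/exprn_ge0.
Qed.

Let J := closure (range ip_sum).

Let JP a : J a <-> forall e, 0 < e -> exists s, rnorm (a - ip_sum s) < e.
Proof.
split=> [/closure_rnormP Ja e /Ja|Ja].
  by move=> [_ [s _ <-] ?]; exists s.
by apply/closure_rnormP => e /Ja[s ?]; exists (ip_sum s) => //; exists s.
Qed.

Lemma closure_ip_ideal : cstar_ideal J.
Proof.
split.
- exact: closed_closure.
- by apply/JP => e e0; exists [::]; rewrite /ip_sum big_nil subrr rnorm0.
- move=> a b /JP Ja /JP Jb; apply/JP => e e0.
  have e2 : 0 < e / 2 by rewrite divr_gt0.
  have [[s sa] [s' sb]] := (Ja _ e2, Jb _ e2); exists (s ++ s').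
  rewrite -ip_sumD opprD addrACA (splitr e).
  by apply: le_lt_trans (ler_rnormD _ _) _; apply: ltrD.
- move=> k a /JP Ja; apply/JP => e e0.
  have k0 : 0 < complex.Re `|k| + 1 by rewrite ltr_wpDl // -ler0c RRe_real ?ger0_real.
  have [s sa] := Ja _ (divr_gt0 e0 k0).
  exists [seq (k *: p.1, p.2) | p <- s].
  rewrite -ip_sumZ -scalerBr rnormZ.
  move: sa; rewrite ltr_pdivlMr // mulrC => /(le_lt_trans _); apply.
  by rewrite ler_wpM2r ?rnorm_ge0 // lerDl.
- move=> a b /JP Jb; have a0 : 0 < rnorm a + 1 by rewrite ltr_wpDl ?rnorm_ge0.
  split; apply/JP => e e0; have [s sb] := Jb _ (divr_gt0 e0 a0);
    move: sb; rewrite ltr_pdivlMr // mulrDr mulr1 => sb.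
    exists [seq (phi a p.1, p.2) | p <- s]; rewrite -smul_ip_sum -smulBr.
    apply: le_lt_trans (rnormM _ _) _; rewrite mulrC.
    by apply: le_lt_trans sb; rewrite lerDl rnorm_ge0.
  have [s' bs'] := ip_sum_smul a s; exists s'; rewrite -bs' -smulBl.
  apply: le_lt_trans (rnormM _ _) _.
  by apply: le_lt_trans sb; rewrite lerDl rnorm_ge0.
Qed.

Lemma closure_ip_hom0_smul a b : phi a = 0 -> J b -> a ** b = 0.
Proof.
move=> a0 /JP Jb; apply: rnorm_le0; rewrite leNgt; apply/negP => ab0.
have a10 : 0 < rnorm a + 1 by rewrite ltr_wpDl ?rnorm_ge0.
have [s sb] := Jb _ (divr_gt0 ab0 a10).
have as0 : a ** ip_sum s = 0.
  by rewrite smul_ip_sum /ip_sum big_map big1 // => p _ /=; rewrite a0 op0 (ip0l I).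
move: sb; rewrite ltr_pdivlMr // -[a ** b]subr0 -as0 -smulBr.
have := rnormM a (b - ip_sum s); have := rnorm_ge0 (b - ip_sum s); nra.
Qed.

Lemma closure_ip_star a : J a -> J (star a).
Proof.
move=> /JP Ja; apply/JP => e /Ja[s sa]; exists [seq (p.2, p.1) | p <- s].
by rewrite -star_ip_sum -starB rnorm_star.
Qed.

(** For surjectivity, finite sums of rank-one operators that converge to T lift
    to finite sums of values of [ip], and these are Cauchy by isometry. *)
Lemma closure_ip_bij : set_bij J (compact_ops X) phi.
Proof.
have [_ _ JD JZ _] := closure_ip_ideal.
split=> [a /JP Ja|a b|T /compact_opsP Tc].
- apply/compact_opsP => e /Ja[s sa]; exists s.
  by rewrite -ip_sum_hom -homB //; apply: bnd_le (ltW sa) (star_hom_contractive _ _).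
- rewrite !inE => Ja Jb ab; apply/eqP; rewrite -subr_eq0; apply/eqP.
  have d0 : phi (a - b) = 0 by rewrite homB // ab subrr.
  have Jd : J (a - b) by apply: JD => //; rewrite -scaleN1r; exact: JZ.
  have /cstar_eq0 : star (star (a - b)) ** star (a - b) = 0.
    by rewrite starK; apply: closure_ip_hom0_smul => //; exact: closure_ip_star.
  by move/(congr1 star); rewrite starK star0.
- have /choice[u uT] : forall n, exists s, bnd (T - rank_sum s) (sqgap n).
    by move=> n; apply: Tc; exact: sqgap_gt0.
  have [|m n nm|a au] := @rnorm_complete R A (ip_sum \o u) (fun n => 2 * sqgap n).
  + by move=> e e0; exact: sqgap_small.
  + have [s' us'] := ip_sumN (u n).
    rewrite /= us' ip_sumD; apply: ip_sum_isometric.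
      by rewrite mulr_ge0 ?sqgap_ge0.
    rewrite -ip_sum_hom -ip_sumD -us' homB // !ip_sum_hom.
    rewrite -(subrKA T) mulrDl mul1r; apply: bndD; last exact: uT.
    rewrite -opprB; apply: bndN; apply: bnd_le (uT m).
    by rewrite lerD2l lerN2 sqseq_homo.
  exists a.
    apply/JP => e e0; have [n ne] := sqgap_small 2 e0.
    by exists (u n); exact: le_lt_trans (au n) ne.
  apply/eqP; rewrite -subr_eq0; apply/eqP/(@bnd_small _ _ _ _ 3) => n.
  rewrite -(subrKA (rank_sum (u n))).
  rewrite (_ : 3 * sqgap n = 2 * sqgap n + sqgap n); last by ring.
  apply: bndD; last by rewrite -opprB; apply: bndN.
  rewrite -ip_sum_hom -homB //.
  exact: bnd_le (au n) (star_hom_contractive _ _).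
Qed.

End BimoduleToIdeal.

Theorem corollary4p11 (R : realType) (A B : cstarAlgType R)
    (X : hilbertModType B) (phi : A -> adjop X) (phi_hom : star_hom phi) :
  (exists! ip : X -> X -> A, hilbert_bimodule (fun a x => phi a x) ip) <->
  (exists J : set A, cstar_ideal J /\ set_bij J (compact_ops X) phi).
Proof.
split=> [[ip [/hilbert_bimodule_ip I _]]|[J [J_ideal phi_bij]]].
  exists (closure (range (ip_sum ip))).
  by split; [exact: (closure_ip_ideal I)|exact: (closure_ip_bij phi_hom I)].
exact: (ideal_bimodule phi_hom J_ideal phi_bij).
Qed.
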